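(* Let $\mathbb{K}\in\{\mathbb{R},\mathbb{C}\}$, let $(\Omega,\mathcal{F},\mu)$ be a measure space, let $H:=\mathrm{L}_2(\Omega,\mathcal{F},\mu)$ (scalar field $\mathbb{K}$), and define $\Phi(a):=M_a$ for $a\in\mathcal{M}(\Omega,\mathcal{F})$. Then $\Phi$ (that is, $(\Phi,H)$) is a measurable functional calculus on $(\Omega,\mathcal{F})$.
   Context: For measurable $a:\Omega\to\mathbb{K}$, the multiplication operator $M_a$ on $\mathrm{L}_2(\Omega,\mathcal{F},\mu)$ is defined by $M_af:=af$ for $f\in\mathrm{dom}(M_a):=\{f\in\mathrm{L}_2(\Omega,\mathcal{F},\mu) : af\in\mathrm{L}_2(\Omega,\mathcal{F},\mu)\}$. For a measurable space $(X,\Sigma)$ let $\mathcal{M}(X,\Sigma)$ be the algebra of measurable functions $X\to\mathbb{K}$. For a Hilbert space $H$ let $\mathcal{C}(H)$ be the set of closed linear operators in $H$ (linear, defined on a subspace $\mathrm{dom}\subseteq H$, with closed graph; not assumed densely defined) and $\mathcal{L}(H)$ the bounded everywhere defined ones. Sums and products of operators have their natural (maximal) domains and $A\subseteq B$ means inclusion of graphs. A measurable (functional) calculus on $(X,\Sigma)$ is a pair $(\Phi,H)$, $H$ a Hilbert space over $\mathbb{K}$, $\Phi:\mathcal{M}(X,\Sigma)\to\mathcal{C}(H)$, such that for all $f,g\in\mathcal{M}(X,\Sigma)$, $\lambda\in\mathbb{K}$: (MFC1) $\Phi(\mathbf{1})=\mathrm{I}$; (MFC2) $\Phi(f)+\Phi(g)\subseteq\Phi(f+g)$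 and $\lambda\Phi(f)\subseteq\Phi(\lambda f)$; (MFC3) $\Phi(f)\Phi(g)\subseteq\Phi(fg)$ and $\mathrm{dom}(\Phi(f)\Phi(g))=\mathrm{dom}(\Phi(g))\cap\mathrm{dom}(\Phi(fg))$; (MFC4) $\Phi(f)\in\mathcal{L}(H)$ and $\Phi(f)^*=\Phi(\overline{f})$ if $f$ is bounded; (MFC5) if $(f_n)_n$ are bounded measurable with $\sup_n\|f_n\|_\infty<\infty$ and $f_n\to f$ pointwise, then $\Phi(f_n)\to\Phi(f)$ in the weak operator topology. *)

(* Defs.v *)
From HB Require Import structures.
From mathcomp Require Import all_boot all_order all_algebra.
From mathcomp Require Import complex.
From mathcomp Require Import all_classical all_reals all_analysis.
From mathcomp Require Import measurable_realfun.
From mathcomp Require Import ring lra.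

Set Implicit Arguments.
Unset Strict Implicit.
Unset Printing Implicit Defensive.
Set Warnings "-redundant-canonical-projection".
Import Order.TTheory GRing.Theory Num.Theory.
Import numFieldNormedType.Exports.
Local Open Scope classical_set_scope.
Local Open Scope ring_scope.
Local Open Scope complex_scope.
Local Open Scope quotient_scope.

Variant scalar_kind := RealScalars | ComplexScalars.

(* The scalar field is literally R or R[i], according to k; RorC is this field
   as a constant type, so that it can carry its own canonical instances. *)
Definition RorC_field (R : realType) (k : scalar_kind) : numFieldType :=
  match k with RealScalars => R | ComplexScalars => R[i] end.

Definition RorC (R : realType) (k : scalar_kind) : Type := RorC_field R k.
HB.instance Definition _ R k := Num.NumField.copy (RorC R k) (RorC_field R k).
HB.instance Definition _ R k :=
  PseudoPointedMetric.copy (RorC R k) (RorC_field R k).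
HB.instance Definition _ R k :=
  NormedModule.copy (RorC R k) (RorC_field R k)^o.

(* Borel sigma-algebra, so that {mfun X >-> RorC R k} are the measurable
   functions X -> K. *)
HB.instance Definition _ R k :=
  Measurable.copy (RorC R k) (g_sigma_algebraType (@open (RorC R k))).

Section RorC_theory.
Context (R : realType) (k : scalar_kind).
Local Notation K := (RorC R k).

(* RorC_mk x y is x + i y over C and x over R; in particular RorC_mk x 0 is the
   embedding of R into K. *)
Definition RorC_re : K -> R :=
  match k return RorC R k -> R with
  | RealScalars => fun x => x | ComplexScalars => fun z => complex.Re z end.
Definition RorC_im : K -> R :=
  match k return RorC R k -> R with
  | RealScalars => fun=> 0 | ComplexScalars => fun z => complex.Im z end.
Definition RorC_conj : K -> K :=
  match k return RorC R k -> RorC R k with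
  | RealScalars => fun x => x | ComplexScalars => fun z => conjc z end.
Definition RorC_mk : R -> R -> K :=
  match k return R -> R -> RorC R k with
  | RealScalars => fun x _ => x | ComplexScalars => fun x y => x +i* y end.
(* The norm of K takes its values in K; this is the same number in R. *)
Definition RorC_abs (x : K) : R := RorC_re `|x|.
End RorC_theory.

Section RorC_lemmas.
Context (R : realType) (k : scalar_kind).
Local Notation K := (RorC R k).
Local Notation re := (@RorC_re R k).
Local Notation im := (@RorC_im R k).
Local Notation conj := (@RorC_conj R k).
Local Notation mk := (@RorC_mk R k).
Local Notation abs := (@RorC_abs R k).
Implicit Types x y : K.

Lemma RorC_eta x : mk (re x) (im x) = x.
Proof. by rewrite /mk /re /im; case: k x => //= -[]. Qed.

Lemma RorC_ext x y : re x = re y -> im x = im y -> x = y.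
Proof. by move=> e1 e2; rewrite -(RorC_eta x) -(RorC_eta y) e1 e2. Qed.

Lemma RorC_re_mk (a b : R) : re (mk a b) = a.
Proof. by rewrite /mk /re; case: k. Qed.

Lemma RorC_im_mk0 (a : R) : im (mk a 0) = 0.
Proof. by rewrite /mk /im; case: k. Qed.

Lemma RorC_im_conj x : im (conj x) = - im x.
Proof. by rewrite /conj /im; case: k x => //= [|[]//]; rewrite oppr0. Qed.

Lemma RorC_re_conj x : re (conj x) = re x.
Proof. by rewrite /conj /re; case: k x => //= -[]. Qed.

Lemma RorC_reD x y : re (x + y) = re x + re y.
Proof. by rewrite /re; case: k x y => //= -[a b] [c d]. Qed.

Lemma RorC_imD x y : im (x + y) = im x + im y.
Proof. by rewrite /im; case: k x y => //= [_ _|[a b] [c d]//]; rewrite addr0. Qed.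

Lemma RorC_reM x y : re (x * y) = re x * re y - im x * im y.
Proof.
by rewrite /re /im; case: k x y => //= [x y|[a b] [c d]//]; rewrite mulr0 subr0.
Qed.

Lemma RorC_imM x y : im (x * y) = re x * im y + im x * re y.
Proof.
by rewrite /re /im; case: k x y => //= [x y|[a b] [c d]//]; rewrite mulr0 mul0r addr0.
Qed.

Lemma RorC_normRE x : `|x| = mk (abs x) 0.
Proof.
by rewrite /abs /re /mk; case: k x => //= -[a b].
Qed.

Lemma RorC_absE x : abs x = Num.sqrt (re x ^+ 2 + im x ^+ 2).
Proof.
rewrite /abs /re /im; case: k x => //= [x|[a b]//].
by rewrite expr0n/= addr0 sqrtr_sqr.
Qed.

Lemma RorC_abs_ge0 x : 0 <= abs x. Proof. by rewrite RorC_absE sqrtr_ge0. Qed.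

Lemma RorC_sqr_abs x : abs x ^+ 2 = re x ^+ 2 + im x ^+ 2.
Proof. by rewrite RorC_absE sqr_sqrtr// addr_ge0// sqr_ge0. Qed.

Lemma RorC_mk_le (a b : R) : (mk a 0 <= mk b 0 :> K) = (a <= b).
Proof. by rewrite /mk; case: k => //=; rewrite lecR. Qed.

Lemma RorC_mk_lt (a b : R) : (mk a 0 < mk b 0 :> K) = (a < b).
Proof. by rewrite /mk; case: k => //=; rewrite ltcR. Qed.

Lemma RorC_mkD (a b : R) : mk a 0 + mk b 0 = mk (a + b) 0 :> K.
Proof. by apply: RorC_ext; rewrite ?RorC_reD ?RorC_imD ?RorC_re_mk ?RorC_im_mk0 ?addr0. Qed.

Lemma RorC_mkM (a b : R) : mk a 0 * mk b 0 = mk (a * b) 0 :> K.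
Proof.
by apply: RorC_ext; rewrite ?RorC_reM ?RorC_imM ?RorC_re_mk ?RorC_im_mk0 ?(mulr0, mul0r, addr0, subr0).
Qed.

Lemma RorC_mk0 : mk 0 0 = 0 :> K. Proof. by rewrite /mk; case: k. Qed.

Lemma RorC_absM x y : abs (x * y) = abs x * abs y.
Proof.
by have := normrM x y; rewrite !RorC_normRE RorC_mkM => /(congr1 re); rewrite !RorC_re_mk.
Qed.

Lemma RorC_absD x y : abs (x + y) <= abs x + abs y.
Proof. by have := ler_normD x y; rewrite !RorC_normRE RorC_mkD RorC_mk_le. Qed.

Lemma RorC_abs_eq0 x : abs x = 0 -> x = 0.
Proof. by move=> x0; apply/normr0_eq0; rewrite RorC_normRE x0 RorC_mk0. Qed.

Lemma RorC_abs0 : abs 0 = 0.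
Proof. by have := @normr0 _ K; rewrite RorC_normRE => /(congr1 re); rewrite RorC_re_mk -RorC_mk0 RorC_re_mk. Qed.

Lemma RorC_abs_conj x : abs (conj x) = abs x.
Proof. by rewrite !RorC_absE RorC_re_conj RorC_im_conj sqrrN. Qed.

Lemma RorC_le_re_abs x : `|re x| <= abs x.
Proof. by rewrite RorC_absE -sqrtr_sqr ler_wsqrtr// lerDl sqr_ge0. Qed.

Lemma RorC_le_im_abs x : `|im x| <= abs x.
Proof. by rewrite RorC_absE -sqrtr_sqr ler_wsqrtr// lerDr sqr_ge0. Qed.

Lemma RorC_abs_le x : abs x <= `|re x| + `|im x|.
Proof.
rewrite RorC_absE -[leRHS]ger0_norm ?addr_ge0// -sqrtr_sqr ler_wsqrtr//.
rewrite sqrrD !real_normK ?num_real// lerD2r lerDl.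
by rewrite mulrn_wge0// mulr_ge0.
Qed.

Lemma RorC_reB x y : re (x - y) = re x - re y.
Proof. by apply/eqP; rewrite eq_sym subr_eq -RorC_reD subrK. Qed.

Lemma RorC_imB x y : im (x - y) = im x - im y.
Proof. by apply/eqP; rewrite eq_sym subr_eq -RorC_imD subrK. Qed.

Lemma ball_RorC x (e : R) : ball x (mk e 0) = [set y | abs (x - y) < e].
Proof.
apply/seteqP; split=> y /=; rewrite -ball_normE /ball_/= RorC_normRE RorC_mk_lt//.
Qed.

Lemma nbhs_RorC x (U : set K) : nbhs x U <->
  exists2 e : R, 0 < e & [set y | abs (x - y) < e] `<=` U.
Proof.
split.
  move=> /nbhs_ballP[e /= e0 eU].
  have eE : e = mk (re e) 0.
    have := RorC_normRE e; rewrite gtr0_norm// => {1}->.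
    by rewrite /abs gtr0_norm.
  exists (re e); first by rewrite -RorC_mk_lt RorC_mk0 -eE.
  by rewrite -ball_RorC -eE.
move=> [e e0 eU]; apply/nbhs_ballP; exists (mk e 0) => /=.
  by rewrite -[X in X < _]RorC_mk0 RorC_mk_lt.
by rewrite ball_RorC.
Qed.

Lemma open_measurable_RorC (U : set K) : open U -> measurable U.
Proof. exact: sub_sigma_algebra. Qed.

Lemma measurable_RorC_re : measurable_fun setT re.
Proof.
apply: (measurability _ (RGenOpens.measurableE R)).
move=> _ [_ [a [b ->] <-]]; rewrite setTI.
suff: @open K (re @^-1` `]a, b[) by exact: open_measurable_RorC.
rewrite openE => x /= xab.
have /nbhs_ballP[e /= e0 eU] : nbhs (re x) `]a, b[%classic.
  exact: open_nbhs_nbhs.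
apply/nbhs_RorC; exists e => // y /= xy.
apply: eU; rewrite -ball_normE/= -RorC_reB.
exact: le_lt_trans (RorC_le_re_abs _) _.
Qed.

Lemma measurable_RorC_im : measurable_fun setT im.
Proof.
apply: (measurability _ (RGenOpens.measurableE R)).
move=> _ [_ [a [b ->] <-]]; rewrite setTI.
suff: @open K (im @^-1` `]a, b[) by exact: open_measurable_RorC.
rewrite openE => x /= xab.
have /nbhs_ballP[e /= e0 eU] : nbhs (im x) `]a, b[%classic.
  exact: open_nbhs_nbhs.
apply/nbhs_RorC; exists e => // y /= xy.
apply: eU; rewrite -ball_normE/= -RorC_imB.
exact: le_lt_trans (RorC_le_im_abs _) _.
Qed.

Lemma measurable_RorC d (X : measurableType d) (f : X -> K) :
  measurable_fun setT f <->
  measurable_fun setT (re \o f) /\ measurable_fun setT (im \o f).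
Proof.
split=> [mf|[mr mi]].
  split; apply: measurableT_comp => //; [exact: measurable_RorC_re|exact: measurable_RorC_im].
apply: (measurability (@open K)) => //.
move=> _ [U oU <-]; rewrite setTI.
pose B (q : rat * rat * rat) : set K := [set y |
  `|re y - ratr q.1.1| < ratr q.2 /\ `|im y - ratr q.1.2| < ratr q.2].
pose F q : set X := if `[< B q `<=` U >] then f @^-1` (B q) else set0.
have -> : f @^-1` U = \bigcup_q F q.
  apply/seteqP; split=> [x /= Ufx|x [q _]]; last first.
    by rewrite /F; case: asboolP => // BU /BU.
  have /nbhs_RorC[e e0 eU] : nbhs (f x) U by exact: open_nbhs_nbhs.
  have /rat_in_itvoo[r /itvP rP] : (0 : R) < e / 4 by rewrite divr_gt0.
  have r0 : 0 < ratr r :> R by rewrite rP.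
  have re4 : ratr r < e / 4 :> R by rewrite rP.
  have [p Hp] : exists p : rat, `|re (f x) - ratr p| < ratr r.
    have /rat_in_itvoo[p /itvP pP] : re (f x) < re (f x) + ratr r by rewrite ltrDl.
    exists p; rewrite distrC ger0_norm ?subr_ge0 ?pP//.
    by rewrite ltrBlDl pP.
  have [q Hq] : exists p : rat, `|im (f x) - ratr p| < ratr r.
    have /rat_in_itvoo[p' /itvP pP] : im (f x) < im (f x) + ratr r by rewrite ltrDl.
    exists p'; rewrite distrC ger0_norm ?subr_ge0 ?pP//.
    by rewrite ltrBlDl pP.
  exists (p, q, r) => //; rewrite /F; case: asboolP => //=.
  case=> y [/= yp yq]; apply: eU => /=.
  apply: (le_lt_trans (RorC_abs_le _)); rewrite RorC_reB RorC_imB.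
  have h1 := ler_distD (ratr p) (re (f x)) (re y).
  have h2 := ler_distD (ratr q) (im (f x)) (im y).
  rewrite distrC in yp; rewrite distrC in yq.
  move: h1 h2 yp yq Hp Hq re4; set u1 := `|_ - re y|; set u2 := `|_ - im y|.
  move=> *; lra.
apply: countable_bigcupT_measurable => // q.
rewrite /F; case: asboolP => // _.
have -> : f @^-1` B q =
  ((re \o f) @^-1` (ball (ratr q.1.1 : R) (ratr q.2 : R))) `&`
  ((im \o f) @^-1` (ball (ratr q.1.2 : R) (ratr q.2 : R))).
  by apply/seteqP; split=> x /=; rewrite -!ball_normE /B/= !(distrC (ratr _)).
apply: measurableI.
- rewrite -[X in measurable X]setTI; apply: mr => //; exact: measurable_ball.
- rewrite -[X in measurable X]setTI; apply: mi => //; exact: measurable_ball.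
Qed.

End RorC_lemmas.

Section RorC_mfun.
Context (R : realType) (k : scalar_kind) d (X : measurableType d).
Local Notation K := (RorC R k).
Implicit Types f g : X -> K.

Lemma measurable_RorC_cst (c : K) : measurable_fun setT (fun _ : X => c).
Proof. exact: measurable_cst. Qed.

Lemma measurable_RorCD f g : measurable_fun setT f -> measurable_fun setT g ->
  measurable_fun setT (fun x => f x + g x).
Proof.
move=> /measurable_RorC[rf jf] /measurable_RorC[rg jg]; apply/measurable_RorC; split.
- rewrite (_ : _ \o _ = (@RorC_re R k \o f) \+ (@RorC_re R k \o g)).
    exact: measurable_funD.
  by apply/funext => x /=; rewrite RorC_reD.
- rewrite (_ : _ \o _ = (@RorC_im R k \o f) \+ (@RorC_im R k \o g)).
    exact: measurable_funD.
  by apply/funext => x /=; rewrite RorC_imD.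
Qed.

Lemma measurable_RorCM f g : measurable_fun setT f -> measurable_fun setT g ->
  measurable_fun setT (fun x => f x * g x).
Proof.
move=> /measurable_RorC[rf jf] /measurable_RorC[rg jg]; apply/measurable_RorC; split.
- rewrite (_ : _ \o _ = ((@RorC_re R k \o f) \* (@RorC_re R k \o g))
                      \- ((@RorC_im R k \o f) \* (@RorC_im R k \o g))).
    by apply: measurable_funB; exact: measurable_funM.
  by apply/funext => x /=; rewrite RorC_reM.
- rewrite (_ : _ \o _ = ((@RorC_re R k \o f) \* (@RorC_im R k \o g))
                      \+ ((@RorC_im R k \o f) \* (@RorC_re R k \o g))).
    by apply: measurable_funD; exact: measurable_funM.
  by apply/funext => x /=; rewrite RorC_imM.
Qed.

Lemma measurable_RorC_conj f : measurable_fun setT f ->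
  measurable_fun setT (fun x => RorC_conj (f x)).
Proof.
move=> /measurable_RorC[rf jf]; apply/measurable_RorC; split.
- by rewrite (_ : _ \o _ = @RorC_re R k \o f)//; apply/funext => x /=; rewrite RorC_re_conj.
- rewrite (_ : _ \o _ = \- (@RorC_im R k \o f)).
    exact: measurableT_comp.
  by apply/funext => x /=; rewrite RorC_im_conj.
Qed.

Lemma measurable_RorC_abs f : measurable_fun setT f ->
  measurable_fun setT (fun x => RorC_abs (f x)).
Proof.
move=> /measurable_RorC[rf jf].
rewrite (_ : (fun _ => _) = Num.sqrt \o (fun x => (@RorC_re R k \o f) x ^+ 2 + (@RorC_im R k \o f) x ^+ 2)).
  apply: measurableT_comp => //.
    by apply: continuous_measurable_fun; exact: sqrt_continuous.
  by apply: measurable_funD; exact: measurable_funX.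
by apply/funext => x /=; rewrite RorC_absE.
Qed.
End RorC_mfun.

Section RorC_conj_morphism.
Context (R : realType) (k : scalar_kind).
Implicit Types x y : RorC R k.

Lemma RorC_conjD x y : RorC_conj (x + y) = RorC_conj x + RorC_conj y.
Proof. by apply: RorC_ext; rewrite ?(RorC_re_conj, RorC_im_conj, RorC_reD, RorC_imD)// opprD. Qed.

Lemma RorC_conjM x y : RorC_conj (x * y) = RorC_conj x * RorC_conj y.
Proof.
by apply: RorC_ext; rewrite ?(RorC_re_conj, RorC_im_conj, RorC_reM, RorC_imM)// ?mulrNN//; ring.
Qed.

Lemma RorC_conjK : involutive (@RorC_conj R k).
Proof. by move=> x; apply: RorC_ext; rewrite ?(RorC_re_conj, RorC_im_conj)// opprK. Qed.

Lemma RorC_conj1 : RorC_conj (1 : RorC R k) = 1.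
Proof. by have := RorC_conjM 1 (RorC_conj 1); rewrite !mul1r RorC_conjK mulr1 => <-. Qed.

Lemma RorC_conjB : {morph @RorC_conj R k : x y / x - y}.
Proof. by move=> x y; apply/eqP; rewrite eq_sym subr_eq -RorC_conjD subrK. Qed.

HB.instance Definition _ := GRing.isZmodMorphism.Build _ _ (@RorC_conj R k) RorC_conjB.
HB.instance Definition _ := GRing.isMonoidMorphism.Build _ _ (@RorC_conj R k)
  (RorC_conj1, RorC_conjM).
End RorC_conj_morphism.

(* The inner product is linear in its first argument. Completeness is not part
   of the structure, see [hilbert_space] below. *)
HB.mixin Record NormedModule_isPreHilbert (R : realType) (k : scalar_kind) H
    & NormedModule (RorC R k) H := {
  inner : {dot H for @RorC_conj R k};
  innerxx : forall x : H, inner x x = `|x| ^+ 2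
}.

#[short(type="preHilbertType")]
HB.structure Definition PreHilbert (R : realType) (k : scalar_kind) :=
  {H of NormedModule_isPreHilbert R k H & NormedModule (RorC R k) H}.

Section Lnorm2.
Context (R : realType) d (X : measurableType d) (mu : {measure set X -> \bar R}).
Implicit Types f g : X -> R.

Lemma Lnorm2E f : ('N[mu]_2%:E[EFin \o f] =
  (\int[mu]_x (f x ^+ 2)%:E) `^ (2^-1))%E.
Proof.
rewrite unlock /Lnorm; congr (_ `^ _)%E; apply: eq_integral => x _ /=.
by rewrite powR_mulrn// real_normK// num_real.
Qed.

Lemma Lnorm2_le f g : measurable_fun setT f -> measurable_fun setT g ->
  (forall x, `|f x| <= `|g x|) ->
  ('N[mu]_2%:E[EFin \o f] <= 'N[mu]_2%:E[EFin \o g])%E.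
Proof.
move=> mf mg fg; rewrite !Lnorm2E; apply: gt0_ler_poweR => //.
- by rewrite in_itv/= leey andbT integral_ge0// => x _; rewrite lee_fin sqr_ge0.
- by rewrite in_itv/= leey andbT integral_ge0// => x _; rewrite lee_fin sqr_ge0.
apply: ge0_le_integral => //.
- by move=> x _; rewrite lee_fin sqr_ge0.
- by apply/measurable_EFinP; exact: measurable_funX.
- by apply/measurable_EFinP; exact: measurable_funX.
- by move=> x _; rewrite lee_fin -real_normK ?num_real// -[leRHS]real_normK ?num_real// ler_sqr ?nnegrE.
Qed.

Lemma Lnorm2_ae f g : measurable_fun setT f -> measurable_fun setT g ->
  (\forall x \ae mu, f x = g x) ->
  ('N[mu]_2%:E[EFin \o f] = 'N[mu]_2%:E[EFin \o g])%E.
Proof.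
move=> mf mg fg; rewrite !Lnorm2E; congr (_ `^ _)%E.
apply: ge0_ae_eq_integral => //.
- by apply/measurable_EFinP; exact: measurable_funX.
- by apply/measurable_EFinP; exact: measurable_funX.
- by move=> x _; rewrite lee_fin sqr_ge0.
- by move=> x _; rewrite lee_fin sqr_ge0.
- by apply: filterS fg => x -> .
Qed.

Lemma Lfun2P f : f \in Lfun mu 2%:E <->
  measurable_fun setT f /\ finite_norm mu 2%:E f.
Proof.
split; first by rewrite inE => /andP[]; rewrite !inE.
by move=> [mf ff]; rewrite inE; apply/andP; split; rewrite inE.
Qed.
End Lnorm2.

Section L2.
Context (R : realType) (k : scalar_kind) d (X : measurableType d).
Variable mu : {measure set X -> \bar R}.
Local Notation K := (RorC R k).

Definition square_integrable (f : X -> K) :=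
  measurable_fun setT f /\ finite_norm mu 2%:E (fun x => RorC_abs (f x)).

(* L2 is a subset of the a.e.-equality classes of measurable functions; the
   coercion to functions picks a representative of the class. *)
Record L2 := MkL2 {
  L2_class : {mfun_ mu, X >-> K} ;
  L2_square_integrable : square_integrable L2_class }.

Definition L2_fun (f : L2) : X -> K := L2_class f.
Coercion L2_fun : L2 >-> Funclass.
End L2.
Arguments square_integrable {R k d X} mu f.

Section L2_theory.
Context (R : realType) (k : scalar_kind) d (X : measurableType d).
Variable mu : {measure set X -> \bar R}.
Local Notation K := (RorC R k).
Local Notation L2 := (L2 k mu).
Local Notation sqint := (@square_integrable R k d X mu).
Implicit Types (u v w : L2) (f g : X -> K).

Lemma L2_ext u v : (\forall x \ae mu, u x = v x) -> u = v.
Proof.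
case: u v => [u hu] [v hv]; rewrite /L2_fun/= => uv.
have E : u = v.
  rewrite -(reprK u) -(reprK v); apply/eqP; rewrite eqmodE; apply/asboolP.
  by apply: filterS uv.
by case: _ / E in hv *; congr MkL2; exact: Prop_irrelevance.
Qed.

Lemma L2_measurable u : measurable_fun setT u.
Proof. by have [] := L2_square_integrable u. Qed.

Lemma square_integrable_ae f g : measurable_fun setT f ->
  (\forall x \ae mu, f x = g x) -> sqint g -> sqint f.
Proof.
move=> mf fg [mg hg]; split => //; rewrite /finite_norm.
rewrite (@Lnorm2_ae _ _ _ _ _ (fun x => RorC_abs (g x)))//.
- exact: measurable_RorC_abs.
- exact: measurable_RorC_abs.
- by apply: filterS fg => x ->.
Qed.

Definition mfun_of f (mf : measurable_fun setT f) : {mfun X >-> K} :=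
  mfun_Sub (mem_set mf).

Definition class_of f (mf : measurable_fun setT f) : {mfun_ mu, X >-> K} :=
  \pi_({mfun_ mu, X >-> K}) (mfun_of mf).

Lemma class_ofE f (mf : measurable_fun setT f) :
  \forall x \ae mu, class_of mf x = f x.
Proof.
have : repr (class_of mf) = mfun_of mf %[mod {mfun_ mu, X >-> K}] by rewrite reprK.
by move=> /eqP; rewrite eqmodE => /asboolP; apply: filterS => x; apply.
Qed.

Lemma class_of_square_integrable f (hf : sqint f) : sqint (class_of hf.1).
Proof.
by apply: (square_integrable_ae _ (class_ofE hf.1)) => //.
Qed.

Definition L2_of f (hf : sqint f) : L2 := MkL2 (class_of_square_integrable hf).

Lemma L2_ofE f (hf : sqint f) : \forall x \ae mu, L2_of hf x = f x.
Proof. exact: class_ofE. Qed.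

Lemma square_integrable_le f g : measurable_fun setT f -> sqint g ->
  (forall x, RorC_abs (f x) <= RorC_abs (g x)) -> sqint f.
Proof.
move=> mf [mg hg] fg; split => //; apply: le_lt_trans hg.
apply: Lnorm2_le => [||x]; [exact: measurable_RorC_abs..|].
by rewrite !ger0_norm ?RorC_abs_ge0.
Qed.

Lemma square_integrable0 : sqint (fun=> 0).
Proof.
split; first exact: measurable_RorC_cst.
rewrite /finite_norm (_ : _ \o _ = cst 0%E) ?Lnorm0//.
by apply/funext => x /=; rewrite RorC_abs0.
Qed.

Lemma abs_Lfun f : sqint f -> (fun x => RorC_abs (f x)) \in Lfun mu 2%:E.
Proof. by move=> [mf hf]; apply/Lfun2P; split=> //; exact: measurable_RorC_abs. Qed.

Lemma square_integrableD f g : sqint f -> sqint g -> sqint (fun x => f x + g x).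
Proof.
move=> hf hg; split; first exact: measurable_RorCD hf.1 hg.1.
have h12 : (1 <= 2%:E :> \bar R)%E by rewrite lee_fin ler1n.
have [_ /(_ _ _ (abs_Lfun hf) (abs_Lfun hg))] := Lfun_addr_closed mu h12.
move=> /Lfun2P[m1 h]; apply: le_lt_trans h.
apply: Lnorm2_le => // [|x].
  exact/measurable_RorC_abs/(measurable_RorCD hf.1 hg.1).
by rewrite /= !ger0_norm ?addr_ge0 ?RorC_abs_ge0// RorC_absD.
Qed.

Lemma square_integrableZ (a : K) f : sqint f -> sqint (fun x => a * f x).
Proof.
move=> hf; have m : measurable_fun setT (fun x => a * f x).
  exact: measurable_RorCM (measurable_RorC_cst _) hf.1.
split => //.
have /Lfun2P[m1 h] := Lfun_scale (RorC_abs a) (ler1n R 2) (abs_Lfun hf).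
apply: le_lt_trans h; apply: Lnorm2_le => // [|x].
  exact: measurable_RorC_abs.
by rewrite /= RorC_absM mulrC.
Qed.

Lemma L2_sqint u : sqint u. Proof. exact: L2_square_integrable. Qed.

Definition L2_zero : L2 := L2_of square_integrable0.
Definition L2_add u v : L2 := L2_of (square_integrableD (L2_sqint u) (L2_sqint v)).
Definition L2_scale (a : K) u : L2 := L2_of (square_integrableZ a (L2_sqint u)).
Definition L2_opp u : L2 := L2_scale (-1) u.

Lemma L2_zeroE : \forall x \ae mu, L2_zero x = 0. Proof. exact: L2_ofE. Qed.
Lemma L2_addE u v : \forall x \ae mu, L2_add u v x = u x + v x.
Proof. exact: L2_ofE. Qed.
Lemma L2_scaleE a u : \forall x \ae mu, L2_scale a u x = a * u x.
Proof. exact: L2_ofE. Qed.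
Lemma L2_oppE u : \forall x \ae mu, L2_opp u x = - u x.
Proof. by apply: filterS (L2_scaleE (-1) u) => x ->; rewrite mulN1r. Qed.

Lemma L2_addA : associative L2_add.
Proof.
move=> u v w; apply: L2_ext.
apply: filter_app (L2_addE u (L2_add v w)).
move: (L2_addE v w) (L2_addE (L2_add u v) w) (L2_addE u v).
by apply: filterS3 => x e1 e2 e3 ->; rewrite e1 e2 e3 addrA.
Qed.

Lemma L2_addC : commutative L2_add.
Proof.
move=> u v; apply: L2_ext.
by apply: filterS2 (L2_addE u v) (L2_addE v u) => x -> ->; rewrite addrC.
Qed.

Lemma L2_add0 : left_id L2_zero L2_add.
Proof.
move=> u; apply: L2_ext.
by apply: filterS2 (L2_addE L2_zero u) L2_zeroE => x -> ->; rewrite add0r.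
Qed.

Lemma L2_addN : left_inverse L2_zero L2_opp L2_add.
Proof.
move=> u; apply: L2_ext; move: (L2_addE (L2_opp u) u) (L2_oppE u) L2_zeroE.
by apply: filterS3 => x -> -> ->; rewrite addNr.
Qed.

Lemma L2_scaleA a b u : L2_scale a (L2_scale b u) = L2_scale (a * b) u.
Proof.
apply: L2_ext; move: (L2_scaleE a (L2_scale b u)) (L2_scaleE b u) (L2_scaleE (a * b) u).
by apply: filterS3 => x -> -> ->; rewrite mulrA.
Qed.

Lemma L2_scale1 : left_id 1 L2_scale.
Proof.
by move=> u; apply: L2_ext; apply: filterS (L2_scaleE 1 u) => x ->; rewrite mul1r.
Qed.

Lemma L2_scaleDr : right_distributive L2_scale L2_add.
Proof.
move=> a u v; apply: L2_ext.
apply: filter_app (L2_scaleE a (L2_add u v)); apply: filter_app (L2_addE u v).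
move: (L2_addE (L2_scale a u) (L2_scale a v)) (L2_scaleE a u) (L2_scaleE a v).
by apply: filterS3 => x e1 e2 e3 e4 e5; rewrite e1 e2 e3 e5 e4 mulrDr.
Qed.

Lemma L2_scaleDl u : {morph L2_scale^~ u : a b / a + b >-> L2_add a b}.
Proof.
move=> a b; apply: L2_ext; apply: filter_app (L2_scaleE (a + b) u).
move: (L2_addE (L2_scale a u) (L2_scale b u)) (L2_scaleE a u) (L2_scaleE b u).
by apply: filterS3 => x e1 e2 e3 ->; rewrite e1 e2 e3 mulrDl.
Qed.

HB.instance Definition _ := gen_eqMixin L2.
HB.instance Definition _ := gen_choiceMixin L2.
HB.instance Definition _ :=
  GRing.isZmodule.Build L2 L2_addA L2_addC L2_add0 L2_addN.
HB.instance Definition _ :=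
  GRing.Zmodule_isLmodule.Build K L2 L2_scaleA L2_scale1 L2_scaleDr L2_scaleDl.

Lemma L2_DE u v : \forall x \ae mu, (u + v) x = u x + v x.
Proof. exact: L2_addE. Qed.
Lemma L2_ZE a u : \forall x \ae mu, (a *: u) x = a * u x.
Proof. exact: L2_scaleE. Qed.
Lemma L2_0E : \forall x \ae mu, (0 : L2) x = 0.
Proof. exact: L2_zeroE. Qed.

Definition L2_rnorm u : R := fine ('N[mu]_2%:E[EFin \o (fun x => RorC_abs (u x))])%E.
Definition L2_norm u : K := RorC_mk k (L2_rnorm u) 0.

Lemma L2_rnormE u : ((L2_rnorm u)%:E = 'N[mu]_2%:E[EFin \o (fun x => RorC_abs (u x))])%E.
Proof.
rewrite /L2_rnorm fineK// ge0_fin_numE ?Lnorm_ge0//.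
by have [_] := L2_sqint u.
Qed.

Lemma L2_rnorm_ge0 u : 0 <= L2_rnorm u.
Proof. by rewrite -lee_fin L2_rnormE Lnorm_ge0. Qed.

Lemma L2_mabs u : measurable_fun setT (fun x => RorC_abs (u x)).
Proof. exact/measurable_RorC_abs/L2_measurable. Qed.

Lemma L2_rnorm_sqr u :
  L2_rnorm u ^+ 2 = \int[mu]_x (RorC_abs (u x) ^+ 2).
Proof.
have h0 : (0 <= \int[mu]_x ((RorC_abs (u x)) ^+ 2)%:E)%E.
  by apply: integral_ge0 => x _; rewrite lee_fin sqr_ge0.
have := L2_rnormE u; rewrite Lnorm2E => h.
have : ((L2_rnorm u)%:E `^ 2 = (L2_rnorm u ^+ 2)%:E)%E.
  by rewrite poweR_EFin powR_mulrn// L2_rnorm_ge0.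
rewrite {1}h -poweRrM mulVf// poweRe1// => h2.
by rewrite /Rintegral h2.
Qed.

Lemma L2_norm_triangle u v : L2_norm (u + v) <= L2_norm u + L2_norm v.
Proof.
rewrite /L2_norm RorC_mkD RorC_mk_le -lee_fin EFinD !L2_rnormE.
have mg : measurable_fun setT (fun x => RorC_abs (u x) + RorC_abs (v x)).
  by apply: measurable_funD; exact: L2_mabs.
have H : ('N[mu]_2%:E[EFin \o (fun x => RorC_abs ((u + v)%R x))] <=
   'N[mu]_2%:E[EFin \o (fun x => (RorC_abs (u x) + RorC_abs (v x))%R)])%E.
  rewrite (@Lnorm2_ae _ _ _ _ _ (fun x => RorC_abs (u x + v x))) //.
  - apply: Lnorm2_le => // [|x]; last by rewrite !ger0_norm ?addr_ge0 ?RorC_abs_ge0// RorC_absD.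
    apply/measurable_RorC_abs/measurable_RorCD; exact: L2_measurable.
  - exact: L2_mabs.
  - apply/measurable_RorC_abs/measurable_RorCD; exact: L2_measurable.
  - by apply: filterS (L2_DE u v) => x ->.
apply: (le_trans H); apply: eminkowski; [exact: L2_mabs..|].
by rewrite lee_fin ler1n.
Qed.

Lemma L2_normZ (a : K) u : L2_norm (a *: u) = `|a| * L2_norm u.
Proof.
rewrite /L2_norm RorC_normRE RorC_mkM; congr RorC_mk; apply/eqP.
rewrite -(eqrXn2 (ltn0Sn 1)) ?mulr_ge0 ?RorC_abs_ge0 ?L2_rnorm_ge0//.
rewrite exprMn !L2_rnorm_sqr -RintegralZl//; last first.
  exact/Lfun2_integrable_sqr/abs_Lfun/L2_sqint.
apply/eqP; congr fine; apply: ae_eq_integral => //.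
- by apply/measurable_EFinP; apply: measurable_funX; exact: L2_mabs.
- apply/measurable_EFinP; apply: measurable_funM => //.
  by apply: measurable_funX; exact: L2_mabs.
- by apply: filterS (L2_ZE a u) => x -> _; rewrite RorC_absM exprMn.
Qed.

Lemma L2_norm_eq0 u : L2_norm u = 0 -> u = 0.
Proof.
move=> /(congr1 (@RorC_re R k)); rewrite RorC_re_mk -RorC_mk0 RorC_re_mk => u0.
apply: L2_ext; have := L2_rnormE u; rewrite u0 => /esym /Lnorm_eq0_eq0.
have m : measurable_fun setT (fun x => (RorC_abs (u x))%:E).
  by apply/measurable_EFinP; exact: L2_mabs.
move=> /(_ m (ltr0Sn _ _)) h; apply: filterS2 h L2_0E => x h1 ->.
by apply: RorC_abs_eq0; have [] := h1 I.
Qed.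

HB.instance Definition _ :=
  Lmodule_isNormed.Build K L2 L2_norm_triangle L2_normZ L2_norm_eq0.

End L2_theory.

Section L2_inner.
Context (R : realType) (k : scalar_kind) d (X : measurableType d).
Variable mu : {measure set X -> \bar R}.
Local Notation K := (RorC R k).
Local Notation L2 := (L2 k mu).
Local Notation re := (@RorC_re R k).
Local Notation im := (@RorC_im R k).
Local Notation mk := (@RorC_mk R k).
Implicit Types (u v w : L2) (f g : X -> K).

Definition RorC_integral f : K :=
  mk (\int[mu]_x re (f x)) (\int[mu]_x im (f x)).

Definition L2_inner u v : K := RorC_integral (fun x => u x * RorC_conj (v x)).

Definition RorC_integrable f :=
  mu.-integrable setT (EFin \o (re \o f)) /\ mu.-integrable setT (EFin \o (im \o f)).

Lemma RorC_integrable_measurable f : RorC_integrable f -> measurable_fun setT f.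
Proof.
move=> [/measurable_int/measurable_EFinP m1 /measurable_int/measurable_EFinP m2].
exact/measurable_RorC.
Qed.

Lemma RorC_integrable_abs f : measurable_fun setT f ->
  mu.-integrable setT (EFin \o (fun x => RorC_abs (f x))) -> RorC_integrable f.
Proof.
move=> mf hf; have [mr mi] := (measurable_RorC f).1 mf; split.
- apply: le_integrable hf => //; first exact/measurable_EFinP.
  by move=> x _ /=; rewrite lee_fin [leRHS]ger0_norm ?RorC_abs_ge0// RorC_le_re_abs.
- apply: le_integrable hf => //; first exact/measurable_EFinP.
  by move=> x _ /=; rewrite lee_fin [leRHS]ger0_norm ?RorC_abs_ge0// RorC_le_im_abs.
Qed.

Lemma L2_inner_integrable u v : RorC_integrable (fun x => u x * RorC_conj (v x)).
Proof.
apply: RorC_integrable_abs.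
  apply: measurable_RorCM; first exact: L2_measurable.
  exact/measurable_RorC_conj/L2_measurable.
have := Lfun2_mul_Lfun1 (abs_Lfun (L2_sqint u)) (abs_Lfun (L2_sqint v)).
move=> /Lfun1_integrable; congr (integrable _ _ (_ \o _)).
by apply/funext => x /=; rewrite RorC_absM RorC_abs_conj.
Qed.

Lemma RorC_integral_ae f g : measurable_fun setT f -> measurable_fun setT g ->
  (\forall x \ae mu, f x = g x) -> RorC_integral f = RorC_integral g.
Proof.
move=> /measurable_RorC[rf jf] /measurable_RorC[rg jg] fg.
rewrite /RorC_integral; congr RorC_mk; congr fine; apply: ae_eq_integral => //.
- exact/measurable_EFinP.
- exact/measurable_EFinP.
- by apply: filterS fg => x ->.
- exact/measurable_EFinP.
- exact/measurable_EFinP.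
- by apply: filterS fg => x ->.
Qed.

Lemma RorC_mkP (a b : R) : k = ComplexScalars \/ b = 0 ->
  re (mk a b) = a /\ im (mk a b) = b.
Proof. by rewrite /RorC_re /RorC_im /RorC_mk; case: k => //= -[]. Qed.

Lemma RorC_re_integral f : re (RorC_integral f) = \int[mu]_x re (f x).
Proof. by rewrite RorC_re_mk. Qed.

Lemma RorC_im_integral f : im (RorC_integral f) = \int[mu]_x im (f x).
Proof.
apply: (RorC_mkP _ _).2; case: (k) f => f; [right|by left].
by rewrite /= /Rintegral integral0.
Qed.

Lemma RorC_integralD f g : RorC_integrable f -> RorC_integrable g ->
  RorC_integral (fun x => f x + g x) = RorC_integral f + RorC_integral g.
Proof.
move=> [rf jf] [rg jg]; apply: RorC_ext.
- rewrite RorC_reD !RorC_re_integral -RintegralD//.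
  by apply: eq_Rintegral => x _; rewrite RorC_reD.
- rewrite RorC_imD !RorC_im_integral -RintegralD//.
  by apply: eq_Rintegral => x _; rewrite RorC_imD.
Qed.

Lemma integrable_EFinZl (b : R) (h : X -> R) : mu.-integrable setT (EFin \o h) ->
  mu.-integrable setT (EFin \o (fun x => b * h x)).
Proof. by move=> hh; exact: (@integrableZl _ _ _ mu setT measurableT b _ hh). Qed.

Lemma RorC_integralZ (a : K) f : RorC_integrable f ->
  RorC_integral (fun x => a * f x) = a * RorC_integral f.
Proof.
move=> [rf jf]; have I := integrable_EFinZl.
apply: RorC_ext.
- rewrite RorC_reM !RorC_re_integral !RorC_im_integral -!RintegralZl// -RintegralB//; [|exact: I..].
  by apply: eq_Rintegral => x _; rewrite RorC_reM.
- rewrite RorC_imM !RorC_re_integral !RorC_im_integral -!RintegralZl// -RintegralD//; [|exact: I..].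
  by apply: eq_Rintegral => x _; rewrite RorC_imM.
Qed.

Lemma RorC_integralC f : RorC_integrable f ->
  RorC_integral (fun x => RorC_conj (f x)) = RorC_conj (RorC_integral f).
Proof.
move=> [rf jf]; apply: RorC_ext.
- rewrite RorC_re_conj !RorC_re_integral; by apply: eq_Rintegral => x _; rewrite RorC_re_conj.
- rewrite RorC_im_conj !RorC_im_integral -mulN1r -RintegralZl//.
  by apply: eq_Rintegral => x _; rewrite RorC_im_conj mulN1r.
Qed.

Lemma L2_inner_measurable u v : measurable_fun setT (fun x => u x * RorC_conj (v x)).
Proof. exact/RorC_integrable_measurable/L2_inner_integrable. Qed.

Lemma L2_innerP (a : K) u v w :
  L2_inner (a *: u + v) w = a * L2_inner u w + L2_inner v w.
Proof.
rewrite /L2_inner -RorC_integralZ; last exact: L2_inner_integrable.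
have iZ : RorC_integrable (fun x => a * (u x * RorC_conj (w x))).
  have [rf jf] := L2_inner_integrable u w; split.
  - rewrite (_ : _ \o _ = (EFin \o (fun x => (re a * re (u x * RorC_conj (w x)))%R))
       \- (EFin \o (fun x => (im a * im (u x * RorC_conj (w x)))%R)))%E.
      by apply: integrableB => //; exact: integrable_EFinZl.
    by apply/funext => x /=; rewrite RorC_reM EFinB.
  - rewrite (_ : _ \o _ = (EFin \o (fun x => (re a * im (u x * RorC_conj (w x)))%R))
       \+ (EFin \o (fun x => (im a * re (u x * RorC_conj (w x)))%R)))%E.
      by apply: integrableD => //; exact: integrable_EFinZl.
    by apply/funext => x /=; rewrite RorC_imM EFinD.
rewrite -RorC_integralD//; last exact: L2_inner_integrable.
apply: RorC_integral_ae; first exact: L2_inner_measurable.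
  apply: measurable_RorCD; last exact: L2_inner_measurable.
  exact: RorC_integrable_measurable.
apply: filterS2 (L2_DE (a *: u) v) (L2_ZE a u) => x -> ->.
by rewrite mulrDl mulrA.
Qed.

Lemma L2_innerC u v : L2_inner u v = RorC_conj (L2_inner v u).
Proof.
rewrite /L2_inner -RorC_integralC; last exact: L2_inner_integrable.
congr RorC_integral; apply/funext => x.
by rewrite RorC_conjM RorC_conjK mulrC.
Qed.

Lemma L2_innerxx u : L2_inner u u = L2_norm u ^+ 2.
Proof.
rewrite expr2 RorC_mkM -expr2; apply: RorC_ext.
  rewrite RorC_re_integral RorC_re_mk L2_rnorm_sqr; apply: eq_Rintegral => x _.
  by rewrite RorC_reM RorC_re_conj RorC_im_conj mulrN opprK -!expr2 RorC_sqr_abs.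
rewrite RorC_im_integral RorC_im_mk0 /Rintegral integral0_eq// => x _.
by rewrite RorC_imM RorC_re_conj RorC_im_conj mulrN (mulrC (im _)) addNr.
Qed.

Lemma L2_inner_bilinear :
  bilinear_for *%R (@RorC_conj R k \; *%R) (L2_inner : L2 -> L2 -> K).
Proof.
split=> [v a u w | u a v w] /=; first exact: L2_innerP.
by rewrite L2_innerC L2_innerP RorC_conjD RorC_conjM -!L2_innerC.
Qed.

HB.instance Definition _ := bilinear_isBilinear.Build K L2 L2 K
  *%R (@RorC_conj R k \; *%R) L2_inner L2_inner_bilinear.

Lemma L2_inner_hermitian u v :
  L2_inner u v = (-1) ^+ false * RorC_conj (L2_inner v u).
Proof. by rewrite expr0 mul1r; exact: L2_innerC. Qed.

HB.instance Definition _ := isHermitianSesquilinear.Build K L2 false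
  (@RorC_conj R k) L2_inner L2_inner_hermitian.

Lemma L2_inner_gt0 u : u != 0 -> 0 < L2_inner u u.
Proof. by move=> u0; rewrite L2_innerxx exprn_gt0// (@normr_gt0 _ L2). Qed.

HB.instance Definition _ := isDotProduct.Build K L2 L2_inner L2_inner_gt0.

HB.instance Definition _ := NormedModule_isPreHilbert.Build R k L2 L2_innerxx.
End L2_inner.

Section measurable_function_operations.
Context (R : realType) (k : scalar_kind) d (X : measurableType d).
Local Notation K := (RorC R k).
Implicit Types f g : {mfun X >-> K}.

Definition mfun_one : {mfun X >-> K} := mfun_of (@measurable_RorC_cst R k d X 1).
Definition mfun_add f g : {mfun X >-> K} :=
  mfun_of (measurable_RorCD (measurable_funPT f) (measurable_funPT g)).
Definition mfun_mul f g : {mfun X >-> K} :=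
  mfun_of (measurable_RorCM (measurable_funPT f) (measurable_funPT g)).
Definition mfun_scale (c : K) f : {mfun X >-> K} :=
  mfun_of (measurable_RorCM (@measurable_RorC_cst R k d X c) (measurable_funPT f)).
Definition mfun_conj f : {mfun X >-> K} :=
  mfun_of (measurable_RorC_conj (measurable_funPT f)).

Lemma mfun_oneE x : mfun_one x = 1. Proof. by []. Qed.
Lemma mfun_addE f g x : mfun_add f g x = f x + g x. Proof. by []. Qed.
Lemma mfun_mulE f g x : mfun_mul f g x = f x * g x. Proof. by []. Qed.
Lemma mfun_scaleE c f x : mfun_scale c f x = c * f x. Proof. by []. Qed.
Lemma mfun_conjE f x : mfun_conj f x = RorC_conj (f x). Proof. by []. Qed.

End measurable_function_operations.
Arguments mfun_one {R k d X}.

(* An operator in H is represented by its graph, a subset of H * H; thus A `<=` B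
   is the inclusion of operators, and equality of operators (domains included)
   is equality of sets. *)
Section operators.
Context (R : realType) (k : scalar_kind) (H : preHilbertType R k).
Local Notation K := (RorC R k).
Implicit Types A B : set (H * H).

Definition hilbert_space : Prop :=
  forall F : set_system H, ProperFilter F -> cauchy F -> cvg F.

Definition linear_operator A : Prop :=
  [/\ A (0, 0),
      forall (c : K) p q, A p -> A q -> A (c *: p + q) &
      forall x y z, A (x, y) -> A (x, z) -> y = z].

Definition closed_operator A : Prop := linear_operator A /\ closed A.

Definition op_dom A : set H := [set x | exists y, A (x, y)].

Definition bounded_operator A : Prop :=
  [/\ linear_operator A, op_dom A = setT &
      exists C : R, forall x y, A (x, y) ->
        `|y| <= RorC_mk k C 0 * `|x|].

Definition op_id : set (H * H) := [set p | p.2 = p.1].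

Definition op_add A B : set (H * H) :=
  [set p | exists y z, [/\ A (p.1, y), B (p.1, z) & p.2 = y + z]].

Definition op_scale (c : K) A : set (H * H) :=
  [set p | exists2 y, A (p.1, y) & p.2 = c *: y].

(* the product A B, i.e. B is applied first *)
Definition op_mul A B : set (H * H) :=
  [set p | exists2 y, B (p.1, y) & A (y, p.2)].

Definition op_adjoint A : set (H * H) :=
  [set p | forall x y, A (x, y) -> inner y p.1 = inner x p.2].

(* the value of A at x; it is junk if x is not in the domain of A *)
Definition op_val A (x : H) : H := xget 0 [set y | A (x, y)].

Definition wot_cvg (A_ : nat -> set (H * H)) A : Prop :=
  [/\ forall n, bounded_operator (A_ n), bounded_operator A &
      forall x y, inner (op_val (A_ n) x) y @[n --> \oo] --> inner (op_val A x) y].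

End operators.
Arguments hilbert_space {R k} H.
Arguments op_id {R k} H.

Section measurable_calculus.
Context (R : realType) (k : scalar_kind) d (X : measurableType d).
Local Notation K := (RorC R k).

Definition bounded_function (f : X -> K) : Prop :=
  exists C : R, forall x, RorC_abs (f x) <= C.

Record measurable_calculus (H : preHilbertType R k)
    (Phi : {mfun X >-> K} -> set (H * H)) : Prop := {
  mfc_hilbert : hilbert_space H;
  mfc_closed : forall f, closed_operator (Phi f);
  mfc1 : Phi mfun_one = op_id H;
  mfc2_add : forall f g, op_add (Phi f) (Phi g) `<=` Phi (mfun_add f g);
  mfc2_scale : forall (c : K) f, op_scale c (Phi f) `<=` Phi (mfun_scale c f);
  mfc3_mul : forall f g, op_mul (Phi f) (Phi g) `<=` Phi (mfun_mul f g);
  mfc3_dom : forall f g, op_dom (op_mul (Phi f) (Phi g)) =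
    op_dom (Phi g) `&` op_dom (Phi (mfun_mul f g));
  mfc4_bounded : forall f : {mfun X >-> K}, bounded_function f ->
    bounded_operator (Phi f);
  mfc4_adjoint : forall f : {mfun X >-> K}, bounded_function f ->
    op_adjoint (Phi f) = Phi (mfun_conj f);
  mfc5 : forall (f_ : nat -> {mfun X >-> K}) (f : {mfun X >-> K}),
    (exists C : R, forall n x, RorC_abs (f_ n x) <= C) ->
    (forall x, f_ n x @[n --> \oo] --> f x) ->
    wot_cvg (fun n => Phi (f_ n)) (Phi f)
}.

End measurable_calculus.

Section multiplication_operator.
Context (R : realType) (k : scalar_kind) d (X : measurableType d).
Variable mu : {measure set X -> \bar R}.
Local Notation K := (RorC R k).

Definition mul_op_dom (a : X -> K) : set (L2 k mu) :=
  [set f | square_integrable mu (fun x => a x * f x)].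

Definition mul_op (a : X -> K) : set (L2 k mu * L2 k mu) :=
  [set p : L2 k mu * L2 k mu | mul_op_dom a p.1 /\
    (\forall x \ae mu, p.2 x = a x * p.1 x)].

End multiplication_operator.
Arguments mul_op_dom {R k d X} mu a.
Arguments mul_op {R k d X} mu a.

(* Main.v *)
Require Import Defs.
From mathcomp Require Import all_boot all_order all_algebra.
From mathcomp Require Import all_classical all_reals all_analysis.
From mathcomp Require Import measurable_realfun ring.

(** All the algebraic axioms reduce to one observation: v = M_a u holds in L2
  exactly when v x = a x * u x for almost every x, because membership of the
  product in L2 is then inherited from v ([mul_opP]). With this, linearity and
  the axioms on the unit, sums, multiples and products are pointwise identities
  in the scalar field.

  The heart of the proof is that M_a^* = M_{conj a} for every measurable a,
  bounded or not ([op_adjoint_mul_op]). If <M_a h, f> = <h, g> for all h in the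
  domain of M_a, one tests against h = 1_{|a| <= n} (conj a * f - g): the
  truncation puts h into L2 and into the domain of M_a, and the identity then
  reads <h, h> = 0. Letting n grow gives g = conj a * f almost everywhere. This
  yields the axiom on adjoints, and also closedness: M_a is the adjoint of
  M_{conj a}, and adjoints are closed since the inner product is continuous by
  the Cauchy-Schwarz inequality ([closed_op_adjoint]).

  The axiom on bounded pointwise limits is dominated convergence for
  f_n u conj(v), dominated by
  C |u| |v|, which is integrable ([wot_cvg_mul_op]).

  It remains to see that L2 is complete ([hilbert_space_L2], the theorem of
  Riesz and Fischer). A Cauchy filter yields a sequence u_n with
  |u_m - u_n| <= 2^-n for m >= n. Then the sum of 2^n |u_{n+1} - u_n|^2 has
  finite integral, so it is finite almost everywhere, which forces u_n to
  converge almost everywhere; Fatou's lemma turns the pointwise limit into a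
  limit in L2. *)

Set Implicit Arguments.
Unset Strict Implicit.
Unset Printing Implicit Defensive.
Import Order.TTheory GRing.Theory Num.Theory.
Import numFieldNormedType.Exports.
Local Open Scope classical_set_scope.
Local Open Scope ring_scope.

(** * The scalar field *)

Section scalar_field.
Context (R : realType) (k : scalar_kind).
Local Notation K := (RorC R k).
Implicit Types c : K.

(** Only real numbers are comparable to 0 in K, also over C. Norms are elements
  of K, and this recovers the real numbers behind them. *)
Lemma RorC_ge0E c : 0 <= c -> c = RorC_mk k (RorC_re c) 0.
Proof.
by move=> c0; rewrite -{1}(ger0_norm c0) RorC_normRE /RorC_abs ger0_norm.
Qed.

Lemma RorC_mul_conj c : c * RorC_conj c = `|c| ^+ 2.
Proof.
rewrite RorC_normRE expr2 RorC_mkM -expr2 RorC_sqr_abs; apply: RorC_ext.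
  by rewrite RorC_reM RorC_re_conj RorC_im_conj RorC_re_mk mulrN opprK -!expr2.
by rewrite RorC_imM RorC_re_conj RorC_im_conj RorC_im_mk0 mulrN [X in _ + X]mulrC addNr.
Qed.

Lemma cvg_RorC (z : nat -> K) (c : K) : z n @[n --> \oo] --> c <->
  RorC_re (z n) @[n --> \oo] --> RorC_re c /\
  RorC_im (z n) @[n --> \oo] --> RorC_im c.
Proof.
split=> [zc|[/cvgrPdist_lt zr /cvgrPdist_lt zi]].
  split; apply/cvgrPdist_lt => e e0.
  - near=> n; apply: (@le_lt_trans _ _ (RorC_abs (c - z n))).
      by rewrite -RorC_reB RorC_le_re_abs.
    by near: n; apply: (zc [set y | RorC_abs (c - y) < e]); apply/nbhs_RorC; exists e.
  - near=> n; apply: (@le_lt_trans _ _ (RorC_abs (c - z n))).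
      by rewrite -RorC_imB RorC_le_im_abs.
    by near: n; apply: (zc [set y | RorC_abs (c - y) < e]); apply/nbhs_RorC; exists e.
move=> U /nbhs_RorC[e e0 eU]; have e2 : 0 < e / 2 by rewrite divr_gt0.
apply: filterS2 (zr _ e2) (zi _ e2) => n h1 h2; apply: eU => /=.
apply: le_lt_trans (RorC_abs_le _) _.
by rewrite RorC_reB RorC_imB [e]splitr ltrD.
Unshelve. all: by end_near. Qed.
End scalar_field.

(** * Inner products and adjoints *)

Section inner_product.
Context (R : realType) (k : scalar_kind) (H : preHilbertType R k).
Local Notation K := (RorC R k).
Implicit Types x y z : H.

Lemma innerC x y : inner x y = RorC_conj (inner y x).
Proof. by rewrite hermC expr0 mul1r. Qed.

Lemma innerBl x y z : inner (x - y) z = inner x z - inner y z.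
Proof. exact: linearBl. Qed.

Lemma innerBr x y z : inner x (y - z) = inner x y - inner x z.
Proof. by rewrite innerC innerBl RorC_conjB -!innerC. Qed.

Lemma innerZl (c : K) x y : inner (c *: x) y = c * inner x y.
Proof. exact: linearZl_LR. Qed.

Lemma innerZr (c : K) x y : inner x (c *: y) = RorC_conj c * inner x y.
Proof. by rewrite innerC innerZl RorC_conjM -innerC. Qed.

Lemma cauchy_schwarz x y : `|inner x y| <= `|x| * `|y|.
Proof.
have [->|y0] := eqVneq y 0.
  have -> : inner x 0 = 0 by rewrite innerC (@linear0l _ _ _ _ _ _ inner) rmorph0.
  by rewrite !normr0 mulr0.
rewrite -ler_sqr ?nnegrE ?mulr_ge0// exprMn -!innerxx -RorC_mul_conj -innerC.
have s0 : 0 < inner y y by rewrite innerxx exprn_gt0 ?normr_gt0.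
have sC : RorC_conj (inner y y) = inner y y by rewrite -innerC.
(* This vector is <y,y> times the component of x orthogonal to y. *)
have := exprn_ge0 2 (normr_ge0 (inner y y *: x - inner x y *: y)).
rewrite -innerxx innerBl !innerBr !innerZl !innerZr sC -[RorC_conj (inner x y)]innerC.
suff -> : forall s p c c' : K, s * (s * p) - s * (c' * c) - (c * (s * c') - c * (c' * s))
   = s * (p * s - c * c') by rewrite pmulr_rge0// subr_ge0.
by move=> s p c c'; ring.
Qed.

Lemma continuous_inner x : continuous (inner x : H -> K).
Proof.
move=> y U /nbhs_RorC[e e0 eU].
pose C := RorC_re `|x|.
have xE : `|x| = RorC_mk k C 0 by exact: RorC_ge0E.
have C0 : 0 <= C by rewrite -(RorC_mk_le k) RorC_mk0 -xE.
have d0 : 0 < RorC_mk k (e / (C + 1)) 0.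
  by rewrite -(RorC_mk0 R) RorC_mk_lt divr_gt0// ltr_wpDl.
suff : \forall z \near y, U (inner x z) by [].
near=> z; apply: eU => /=; rewrite -innerBr.
rewrite -(RorC_mk_lt k) -RorC_normRE.
apply: le_lt_trans (cauchy_schwarz _ _) _.
have yz : `|y - z| <= RorC_mk k (e / (C + 1)) 0.
  apply: ltW; near: z; apply/nbhs_ballP; exists (RorC_mk k (e / (C + 1)) 0) => //= w.
  by rewrite -ball_normE.
apply: le_lt_trans (ler_wpM2l (normr_ge0 x) yz) _; rewrite xE.
rewrite RorC_mkM RorC_mk_lt mulrCA -[X in _ < X]mulr1 ltr_pM2l//.
by rewrite ltr_pdivrMr ?mul1r ?ltrDl// ltr_wpDl.
Unshelve. all: by end_near. Qed.

(** The adjoint is an intersection of zero sets, one for each (x, y) in the graph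
  of A, of continuous functions on H * H. *)
Lemma closed_op_adjoint (A : set (H * H)) : closed (op_adjoint A).
Proof.
have -> : op_adjoint A = \bigcap_(q in A)
    (fun p : H * H => inner q.2 p.1 - inner q.1 p.2) @^-1` [set 0].
  apply/seteqP; split=> p /=.
    by move=> h [x y] /= Axy; rewrite (h _ _ Axy) subrr.
  by move=> h x y Axy; apply/eqP; rewrite -subr_eq0; apply/eqP; exact: (h (x, y)).
apply: closed_bigI => -[x y] _; apply: preimage_closed => [p _|].
  apply: (@cvgB K K).
  - by apply: continuous_comp; [exact: cvg_fst|exact: continuous_inner].
  - by apply: continuous_comp; [exact: cvg_snd|exact: continuous_inner].
apply: accessible_closed_set1; apply: hausdorff_accessible.
exact: norm_hausdorff.
Qed.
End inner_product.

(** * Norms and integrals in L2 *)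

Section L2_estimates.
Context (R : realType) (k : scalar_kind) d (X : measurableType d).
Variable mu : {measure set X -> \bar R}.
Local Notation K := (RorC R k).
Local Notation L2 := (L2 k mu).
Implicit Types (u v : L2) (f g : X -> K).

Lemma innerE u v : inner u v = RorC_integral mu (fun x => u x * RorC_conj (v x)).
Proof. by []. Qed.

Lemma L2_normE u : `|u| = RorC_mk k (L2_rnorm u) 0.
Proof. by []. Qed.

Lemma integral_abs_sqr u :
  (\int[mu]_x (RorC_abs (u x) ^+ 2)%:E = (L2_rnorm u ^+ 2)%:E)%E.
Proof.
rewrite L2_rnorm_sqr /Rintegral fineK//.
apply: integrable_fin_num => //.
exact/Lfun2_integrable_sqr/abs_Lfun/L2_sqint.
Qed.

Lemma measurable_abs_sqr f : measurable_fun setT f ->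
  measurable_fun setT (fun x => (RorC_abs (f x) ^+ 2)%:E).
Proof.
by move=> mf; apply/measurable_EFinP; apply: measurable_funX; exact: measurable_RorC_abs.
Qed.

Lemma L2_norm_le_ae u v : (\forall x \ae mu, RorC_abs (u x) <= RorC_abs (v x)) ->
  `|u| <= `|v|.
Proof.
move=> uv; rewrite !L2_normE RorC_mk_le -ler_sqr ?nnegrE ?L2_rnorm_ge0//.
rewrite -lee_fin -!integral_abs_sqr; apply: ae_ge0_le_integral => //.
- by move=> x _; rewrite lee_fin sqr_ge0.
- exact/measurable_abs_sqr/L2_measurable.
- by move=> x _; rewrite lee_fin sqr_ge0.
- exact/measurable_abs_sqr/L2_measurable.
- by apply: filterS uv => x h _; rewrite lee_fin ler_sqr ?nnegrE ?RorC_abs_ge0.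
Qed.

Lemma square_integrable_bounded_mul (b f : X -> K) (C : R) :
  measurable_fun setT b -> (forall x, RorC_abs (b x) <= C) ->
  square_integrable mu f -> square_integrable mu (fun x => b x * f x).
Proof.
move=> mb bC sf.
apply: (square_integrable_le _ (square_integrableZ (RorC_mk k C 0) sf)).
  exact: measurable_RorCM mb sf.1.
move=> x; rewrite !RorC_absM ler_wpM2r ?RorC_abs_ge0//.
have C0 : 0 <= C := le_trans (RorC_abs_ge0 _) (bC x).
rewrite (le_trans (bC x))// -[leLHS](RorC_re_mk k _ 0).
by rewrite (le_trans (ler_norm _))// RorC_le_re_abs.
Qed.

Lemma L2_ae_eq0 u : inner u u = 0 -> \forall x \ae mu, u x = 0.
Proof.
move=> u0; have -> : u = 0.
  by apply/normr0_eq0/eqP; rewrite -sqrf_eq0 -innerxx u0.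
exact: L2_0E.
Qed.

Lemma Rintegral_dominated_cvg (h_ : nat -> X -> R) (h G : X -> R) :
  (forall n, measurable_fun setT (h_ n)) -> measurable_fun setT h ->
  (forall x, h_ n x @[n --> \oo] --> h x) ->
  mu.-integrable setT (EFin \o G) -> (forall n x, `|h_ n x| <= G x) ->
  \int[mu]_x h_ n x @[n --> \oo] --> \int[mu]_x h x.
Proof.
move=> mh_ mh hh iG hG.
have cv : \forall x \ae mu, [set: X] x -> (EFin \o h_ n) x @[n --> \oo] --> (EFin \o h) x.
  by apply: aeW => x _; apply: cvg_EFin; [exact: nearW|exact: hh].
have bd : \forall x \ae mu, forall n, [set: X] x -> (`|(EFin \o h_ n) x| <= (EFin \o G) x)%E.
  by apply: aeW => x n _ /=; rewrite lee_fin.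
have m_ n : measurable_fun setT (EFin \o h_ n) by exact/measurable_EFinP.
have m : measurable_fun setT (EFin \o h) by exact/measurable_EFinP.
have [ih _ hcvg] := dominated_convergence measurableT m_ m cv iG bd.
apply: fine_cvg; rewrite /= fineK; last exact: integrable_fin_num.
exact: hcvg.
Qed.

(** Only the real case has to go through extended real integrals; here it is
  applied to the real and imaginary parts. *)
Lemma RorC_integral_dominated_cvg (h_ : nat -> X -> K) (h : X -> K) (G : X -> R) :
  (forall n, measurable_fun setT (h_ n)) -> measurable_fun setT h ->
  (forall x, h_ n x @[n --> \oo] --> h x) ->
  mu.-integrable setT (EFin \o G) -> (forall n x, RorC_abs (h_ n x) <= G x) ->
  RorC_integral mu (h_ n) @[n --> \oo] --> RorC_integral mu h.
Proof.
move=> mh_ /measurable_RorC[mr mi] hh iG hG; apply/cvg_RorC; split.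
- under eq_fun do rewrite RorC_re_integral; rewrite RorC_re_integral.
  apply: (Rintegral_dominated_cvg _ mr _ iG).
  + by move=> n; have /measurable_RorC[] := mh_ n.
  + by move=> x; have /cvg_RorC[] := hh x.
  + by move=> n x; apply: le_trans (hG n x); exact: RorC_le_re_abs.
- under eq_fun do rewrite RorC_im_integral; rewrite RorC_im_integral.
  apply: (Rintegral_dominated_cvg _ mi _ iG).
  + by move=> n; have /measurable_RorC[] := mh_ n.
  + by move=> x; have /cvg_RorC[] := hh x.
  + by move=> n x; apply: le_trans (hG n x); exact: RorC_le_im_abs.
Qed.
End L2_estimates.

(** * Multiplication operators *)

Section multiplication_operators.
Context (R : realType) (k : scalar_kind) d (X : measurableType d).
Variable mu : {measure set X -> \bar R}.
Local Notation K := (RorC R k).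
Local Notation L2 := (L2 k mu).
Implicit Types (u v f g : L2) (a : {mfun X >-> K}).

(** The domain condition in the definition of a multiplication operator follows
  from the equation: a function that agrees almost everywhere with an element
  of L2 is square integrable as soon as it is measurable. *)
Lemma mul_opP a u v : mul_op mu a (u, v) <-> \forall x \ae mu, v x = a x * u x.
Proof.
split=> [[]//|uv]; split=> //.
apply: (square_integrable_ae _ _ (L2_sqint v)).
  exact: measurable_RorCM (measurable_funPT a) (L2_measurable u).
by apply: filterS uv.
Qed.

Lemma op_dom_mul_op a : op_dom (mul_op mu a) = mul_op_dom mu a.
Proof.
apply/seteqP; split=> u; first by case=> v [].
by move=> h; exists (L2_of h); apply/mul_opP; exact: L2_ofE.
Qed.

Lemma linear_mul_op a : linear_operator (mul_op mu a).
Proof.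
split=> [|c [u v] [u' v']|u v w].
- by apply/mul_opP; apply: filterS (L2_0E k mu) => x ->; rewrite mulr0.
- move=> /mul_opP e1 /mul_opP e2; apply/mul_opP => /=.
  move: (L2_DE (c *: v) v') (L2_ZE c v) (L2_DE (c *: u) u') (L2_ZE c u).
  move=> h1 h2 h3 h4; near=> x.
  rewrite (near h1 x)// (near h2 x)// (near h3 x)// (near h4 x)//.
  rewrite (near e1 x)// (near e2 x)//.
  by rewrite mulrDr mulrCA.
- by move=> /mul_opP e1 /mul_opP e2; apply: L2_ext; apply: filterS2 e1 e2 => x -> ->.
Unshelve. all: by end_near. Qed.

(** The indicator function of the set where |a| <= n, as a scalar function. Both it
  and its product with a are bounded, so multiplying by it brings
  functions into the domain of multiplication by a. *)
Definition truncation a (n : nat) (x : X) : K :=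
  RorC_mk k (\1_[set y | RorC_abs (a y) <= n%:R] x) 0.

Lemma measurable_truncation a n : measurable_fun setT (truncation a n).
Proof.
apply/measurable_RorC; split.
- rewrite (_ : _ \o _ = \1_[set y | RorC_abs (a y) <= n%:R]); last first.
    by apply/funext => x /=; rewrite RorC_re_mk.
  apply: measurable_indic.
  have -> : [set y | RorC_abs (a y) <= n%:R] =
      setT `&` (fun y => RorC_abs (a y)) @^-1` `]-oo, n%:R].
    by rewrite setTI; apply/seteqP; split=> y /=; rewrite in_itv.
  by apply: (measurable_RorC_abs (measurable_funPT a)) => //; exact: measurable_itv.
- rewrite (_ : _ \o _ = cst 0); first exact: measurable_cst.
  by apply/funext => x /=; rewrite RorC_im_mk0.
Qed.

Lemma truncationP a n x :
  (truncation a n x = 1 /\ RorC_abs (a x) <= n%:R) \/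
  (truncation a n x = 0 /\ ~~ (RorC_abs (a x) <= n%:R)).
Proof.
rewrite /truncation indicE; case: (boolP (RorC_abs (a x) <= n%:R)) => h.
  by left; rewrite mem_set//; split=> //; case: (k).
right; rewrite memNset; last exact/negP.
by rewrite RorC_mk0.
Qed.
Lemma abs_truncation_mul a n x : RorC_abs (truncation a n x * a x) <= n%:R.
Proof.
case: (truncationP a n x) => -[-> h]; first by rewrite mul1r.
by rewrite mul0r RorC_abs0.
Qed.

Lemma abs_truncation a n x : RorC_abs (truncation a n x) <= 1.
Proof.
rewrite RorC_absE RorC_re_mk RorC_im_mk0 expr0n addr0 sqrtr_sqr indicE.
by case: (_ \in _); rewrite ?normr1 ?normr0.
Qed.

(** Exchanging a and conj a, this presents every multiplication operator, also an
  unbounded one, as an adjoint. The inclusion from left to right tests the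
  adjoint relation against the truncations 1_{|a| <= n} (conj a * f - g) of the
  function that should vanish. *)
Lemma op_adjoint_mul_op a :
  op_adjoint (mul_op mu a) = mul_op mu (mfun_conj a).
Proof.
apply/seteqP; split=> -[f g]; last first.
  move=> /mul_opP gf u v /mul_opP va /=; rewrite !innerE.
  apply: RorC_integral_ae; [exact: L2_inner_measurable..|].
  apply: filterS2 gf va => x -> ->.
  by rewrite mfun_conjE RorC_conjM RorC_conjK mulrCA mulrA.
move=> adj; apply/mul_opP.
pose w n x := truncation a n x * (RorC_conj (a x) * f x - g x).
have mt n : measurable_fun setT (truncation a n) := measurable_truncation a n.
have ma : measurable_fun setT a := measurable_funPT a.
have sw n : square_integrable mu (w n).
  have s1 : square_integrable mu (fun x => (truncation a n x * RorC_conj (a x)) * f x).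
    apply: (@square_integrable_bounded_mul _ _ _ _ _ _ _ n%:R _ _ (L2_sqint f)).
      exact/measurable_RorCM/measurable_RorC_conj.
    by move=> x; rewrite RorC_absM RorC_abs_conj -RorC_absM abs_truncation_mul.
  have s2 : square_integrable mu (fun x => truncation a n x * g x).
    exact: square_integrable_bounded_mul (mt n) (abs_truncation a n) (L2_sqint g).
  have := square_integrableD s1 (square_integrableZ (-1) s2).
  by congr square_integrable; apply/funext => x; rewrite /w; ring.
have saw n : square_integrable mu (fun x => (truncation a n x * a x) * w n x).
  apply: (@square_integrable_bounded_mul _ _ _ _ _ _ _ n%:R _ _ (sw n)).
    exact: measurable_RorCM (mt n) ma.
  exact: abs_truncation_mul.
have w0 n : \forall x \ae mu, w n x = 0.
  have E1 := L2_ofE (sw n); have E2 := L2_ofE (saw n).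
  set W := L2_of (sw n) in E1; set V := L2_of (saw n) in E2.
  have WV : mul_op mu a (W, V).
    apply/mul_opP; apply: filterS2 E1 E2 => x -> ->; rewrite /w.
    by case: (truncationP a n x) => -[-> _]; rewrite ?mul1r ?mul0r ?mulr0.
  (* On the set where |a| <= n, the integrand of <V,f> - <W,g> is W times the
     conjugate of conj a * f - g, which equals W there; elsewhere V and W vanish. *)
  have WW : inner W W = 0.
    transitivity (inner V f + inner (- W) g); last first.
      have -> : inner (- W) g = - inner W g by exact: linearNl.
      by rewrite (adj _ _ WV) subrr.
    rewrite !innerE -RorC_integralD; [|exact: L2_inner_integrable..].
    apply: RorC_integral_ae; first exact: L2_inner_measurable.
      by apply: measurable_RorCD; exact: L2_inner_measurable.
    apply: filterS3 E1 E2 (L2_oppE W) => x e1 e2 e3.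
    rewrite [(- W) x]e3 e2 e1 /w.
    case: (truncationP a n x) => -[-> _]; rewrite ?(mul1r, mul0r, mulr0, oppr0, addr0)//.
    by rewrite RorC_conjB RorC_conjM RorC_conjK; ring.
  by apply: filterS2 E1 (L2_ae_eq0 WW) => x -> .
apply: filterS (ae_foralln w0) => x wx0.
(* An n that exceeds |a x| puts x into the truncation set. *)
have /(_ (Num.truncn (RorC_abs (a x))).+1) := wx0.
rewrite /w; case: (truncationP a (Num.truncn (RorC_abs (a x))).+1 x) => -[-> h].
  by rewrite mul1r => /eqP; rewrite subr_eq0 => /eqP.
by move: h; rewrite ltW// truncnS_gt.
Qed.

Lemma closed_mul_op a : closed_operator (mul_op mu a).
Proof.
split; first exact: linear_mul_op.
have -> : mul_op mu a = op_adjoint (mul_op mu (mfun_conj a)).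
  rewrite op_adjoint_mul_op; congr mul_op; apply/funext => x.
  by rewrite !mfun_conjE RorC_conjK.
exact: closed_op_adjoint.
Qed.

Lemma bounded_mul_op a : bounded_function a -> bounded_operator (mul_op mu a).
Proof.
move=> [C aC]; split; first exact: linear_mul_op.
  rewrite op_dom_mul_op; apply/seteqP; split=> // u _.
  exact: square_integrable_bounded_mul (measurable_funPT a) aC (L2_sqint u).
exists `|C| => u v /mul_opP uv.
have -> : RorC_mk k `|C| 0 * `|u| = `|RorC_mk k `|C| 0 *: u|.
  by rewrite normrZ ger0_norm// -(RorC_mk0 R) RorC_mk_le.
apply: L2_norm_le_ae; apply: filterS2 uv (L2_ZE (RorC_mk k `|C| 0) u) => x -> ->.
rewrite !RorC_absM ler_wpM2r ?RorC_abs_ge0//.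
apply: (le_trans (aC x)); apply: (le_trans (ler_norm _)).
by rewrite -{1}(RorC_re_mk k `|C| 0) (le_trans (ler_norm _))// RorC_le_re_abs.
Qed.

Lemma mul_op_val a u : bounded_function a ->
  \forall x \ae mu, op_val (mul_op mu a) u x = a x * u x.
Proof.
move=> /bounded_mul_op[_ domT _]; apply/mul_opP.
have [v uv] : op_dom (mul_op mu a) u by rewrite domT.
by rewrite /op_val; case: xgetP => [y _ //|/(_ v)].
Qed.

Lemma wot_cvg_mul_op (a_ : nat -> {mfun X >-> K}) a (C : R) :
  (forall n x, RorC_abs (a_ n x) <= C) ->
  (forall x, a_ n x @[n --> \oo] --> a x) ->
  wot_cvg (fun n => mul_op mu (a_ n)) (mul_op mu a).
Proof.
move=> aC a_a.
have b_ n : bounded_function (a_ n) by exists C.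
have b : bounded_function a.
  (* C + C is a bound that needs only the limits of the real and imaginary parts. *)
  exists (C + C) => x; have /cvg_RorC[hr hi] := a_a x.
  apply: le_trans (RorC_abs_le _) _; apply: lerD.
  - rewrite -(cvg_lim _ (cvg_norm hr))//; apply: limr_le; first exact: cvgP (cvg_norm hr).
    by apply: nearW => n; apply: le_trans (RorC_le_re_abs _) (aC n x).
  - rewrite -(cvg_lim _ (cvg_norm hi))//; apply: limr_le; first exact: cvgP (cvg_norm hi).
    by apply: nearW => n; apply: le_trans (RorC_le_im_abs _) (aC n x).
split=> [n||u v]; [exact: bounded_mul_op..|].
have mw (c : {mfun X >-> K}) : measurable_fun setT (fun x => c x * u x * RorC_conj (v x)).
  apply: measurable_RorCM; last exact/measurable_RorC_conj/L2_measurable.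
  by apply: measurable_RorCM => //; exact: L2_measurable.
have E (c : {mfun X >-> K}) : bounded_function c -> inner (op_val (mul_op mu c) u) v =
    RorC_integral mu (fun x => c x * u x * RorC_conj (v x)).
  move=> bc; rewrite innerE; apply: RorC_integral_ae => //.
    exact: L2_inner_measurable.
  by apply: filterS (mul_op_val u bc) => x ->.
rewrite E//; under eq_fun do rewrite E//.
apply: (RorC_integral_dominated_cvg (G := fun x => C * (RorC_abs (u x) * RorC_abs (v x)))) => //.
- move=> x; under eq_fun do rewrite -mulrA; rewrite -mulrA.
  exact: (cvgM (a_a x) (cvg_cst _)).
- apply: integrable_EFinZl; apply/Lfun1_integrable.
  exact: Lfun2_mul_Lfun1 (abs_Lfun (L2_sqint u)) (abs_Lfun (L2_sqint v)).
- move=> n x; rewrite !RorC_absM RorC_abs_conj -mulrA ler_wpM2r//.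
  by rewrite mulr_ge0// RorC_abs_ge0.
Qed.
End multiplication_operators.

(** * Convergence of sequences of functions *)

Section pointwise_limits.
Context (R : realType).

(** The weights make square summability stronger than summability: either
  w n <= 2^-n, or w n <= 2^n (w n)^2, so w is dominated by the sum of two
  summable sequences. *)
Lemma cvg_series_sqr_weighted (w : R^nat) : (forall n, 0 <= w n) ->
  (\sum_(0 <= n <oo) (2 ^+ n * w n ^+ 2)%:E < +oo)%E -> cvgn (series w).
Proof.
move=> w0 wfin; pose v := (fun n => 2 ^+ n * w n ^+ 2) : R^nat.
have v0 n : 0 <= v n by rewrite mulr_ge0 ?exprn_ge0 ?sqr_ge0.
have cv : cvgn (series v).
  apply: nondecreasing_is_cvgn.
    by apply: nondecreasing_series => n _ _; exact: v0.
  exists (fine (\sum_(0 <= n <oo) (v n)%:E)%E) => _ [n _ <-].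
  rewrite -lee_fin fineK; last first.
    by rewrite ge0_fin_numE ?nneseries_ge0// => m _ _; rewrite lee_fin.
  rewrite /series/= -sumEFin; apply: nneseries_lim_ge => m _ _.
  by rewrite lee_fin.
have h1 : `|2^-1 : R| < 1 by rewrite ger0_norm ?invr_ge0// invf_lt1// ltr1n.
have cg := is_cvg_geometric_series (a := 1) h1.
apply: (series_le_cvg _ _ _ (is_cvg_seriesD cv cg)) => // n.
  by rewrite addr_ge0// /geometric/= mulr_ge0// exprn_ge0// invr_ge0.
rewrite /GRing.add/= /geometric/= mul1r.
(* If w n exceeds 2^-n, then w n <= w n * (2^n w n). *)
have [wn|wn] := leP (w n) (2^-1 ^+ n).
  by apply: (le_trans wn); rewrite lerDr; exact: v0.
apply: (@le_trans _ _ (v n)); last by rewrite lerDl exprn_ge0// invr_ge0.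
rewrite /v expr2 mulrA -[leLHS]mul1r ler_wpM2r//.
by rewrite -ler_pdivrMl ?exprn_gt0// mulr1 -exprVn ltW.
Qed.

Lemma cvg_seq_of_abs_series (z D : R^nat) :
  (forall n, `|z n.+1 - z n| <= D n) -> cvgn (series D) -> cvgn z.
Proof.
move=> zD cD.
have D0 n : 0 <= D n := le_trans (normr_ge0 _) (zD n).
have : cvgn (series (telescope z)).
  apply: normed_cvg; apply: (series_le_cvg _ D0 zD cD) => n.
  exact: normr_ge0.
rewrite telescopeK => c.
have -> : z = [sequence z n - z 0%N]_n + cst (z 0%N).
  by apply/funext => n; rewrite /GRing.add/= subrK.
exact: is_cvgD c (is_cvg_cst _).
Qed.

Lemma RorC_is_cvg (k : scalar_kind) (z : nat -> RorC R k) :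
  cvgn (fun n => RorC_re (z n)) -> cvgn (fun n => RorC_im (z n)) ->
  exists c : RorC R k, z n @[n --> \oo] --> c.
Proof.
move=> cr ci.
exists (RorC_mk k (limn (fun n => RorC_re (z n)))
  (limn (fun n => RorC_im (z n)))).
apply/cvg_RorC; rewrite RorC_re_mk; split=> //.
rewrite (RorC_mkP _ _).2//; case: (k) z {cr ci} => z; [right|by left].
exact: lim_cst.
Qed.

Lemma measurable_RorC_limit (k : scalar_kind) d (X : measurableType d)
    (h : nat -> X -> RorC R k) (v : X -> RorC R k) :
  (forall n, measurable_fun setT (h n)) ->
  (forall x, h n x @[n --> \oo] --> v x) -> measurable_fun setT v.
Proof.
move=> mh hv; apply/measurable_RorC; split.
- apply: (@measurable_fun_cvg _ _ _ _ (fun n => @RorC_re R k \o h n)).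
    by move=> n; have /measurable_RorC[] := mh n.
  by move=> x _; have /cvg_RorC[] := hv x.
- apply: (@measurable_fun_cvg _ _ _ _ (fun n => @RorC_im R k \o h n)).
    by move=> n; have /measurable_RorC[] := mh n.
  by move=> x _; have /cvg_RorC[] := hv x.
Qed.

Lemma limn_einf_le (u : (\bar R)^nat) (c : \bar R) :
  (forall n, u n <= c)%E -> (limn_einf u <= c)%E.
Proof.
move=> uc; rewrite limn_einf_lim; apply: lime_le; first exact: is_cvg_einfs.
apply: nearW => n; apply: le_trans (uc n).
by apply: ereal_inf_lbound; exists n => /=.
Qed.
End pointwise_limits.

(** * Completeness of L2 *)

Section completeness.
Context (R : realType) (k : scalar_kind) d (X : measurableType d).
Variable mu : {measure set X -> \bar R}.
Local Notation K := (RorC R k).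
Local Notation L2 := (L2 k mu).
Implicit Types (u v : L2) (f g : X -> K).

Lemma measurable_RorCB f g : measurable_fun setT f -> measurable_fun setT g ->
  measurable_fun setT (fun x => f x - g x).
Proof.
move=> mf mg.
have := measurable_RorCD mf (measurable_RorCM (measurable_RorC_cst (-1)) mg).
by congr measurable_fun; apply/funext => x; rewrite mulN1r.
Qed.

Lemma L2_rnormB_ae u v f g : measurable_fun setT f -> measurable_fun setT g ->
  (\forall x \ae mu, u x = f x) -> (\forall x \ae mu, v x = g x) ->
  (\int[mu]_x (RorC_abs (f x - g x) ^+ 2)%:E = (L2_rnorm (u - v) ^+ 2)%:E)%E.
Proof.
move=> mf mg uf vg; rewrite -integral_abs_sqr.
have mB : measurable_fun setT (fun x => f x - g x).
  exact: measurable_RorCB.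
apply: ge0_ae_eq_integral => //.
- exact: measurable_abs_sqr.
- exact/measurable_abs_sqr/L2_measurable.
- by move=> x _; rewrite lee_fin sqr_ge0.
- by move=> x _; rewrite lee_fin sqr_ge0.
move: (L2_DE u (- v)) (L2_oppE v) => e1 e2; near=> x => _.
by rewrite (near e1 x)// [(- v) x](near e2 x)// (near uf x)// (near vg x).
Unshelve. all: by end_near. Qed.

Lemma square_integrable_lty f : measurable_fun setT f ->
  (\int[mu]_x (RorC_abs (f x) ^+ 2)%:E < +oo)%E -> square_integrable mu f.
Proof.
move=> mf fin; split=> //; rewrite /finite_norm Lnorm2E.
exact: poweR_lty.
Qed.

(** The weighted sum of the 2^n |u_{n+1} - u_n|^2 has integral at most
  the sum of 2^n 4^-n = 2^-n, so it is finite almost everywhere. The weights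
  replace the usual appeal to Minkowski's inequality for infinite sums. *)
Lemma L2_fast_cauchy_ae_cvg (u : nat -> L2) :
  (forall n, L2_rnorm (u n.+1 - u n) <= 2^-1 ^+ n) ->
  \forall x \ae mu, exists c : K, u n x @[n --> \oo] --> c.
Proof.
move=> uC; pose D n x := RorC_abs (u n.+1 x - u n x).
have mD n : measurable_fun setT (D n).
  apply: measurable_RorC_abs.
  by apply: measurable_RorCB; exact: L2_measurable.
pose s n x := (2 ^+ n * D n x ^+ 2)%:E.
have s0 n x : (0 <= s n x)%E by rewrite lee_fin mulr_ge0 ?sqr_ge0 ?exprn_ge0.
have ms n : measurable_fun setT (s n).
  apply/measurable_EFinP; apply: measurable_funM => //.
  exact: measurable_funX.
(* The bound is 2^-n, in a form in which the series is known to sum to at most 2. *)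
have is_ n : (\int[mu]_x s n x <= (2 / (2 ^ n.+1)%:R)%:E)%E.
  have -> : (\int[mu]_x s n x = (2 ^+ n)%:E * \int[mu]_x (D n x ^+ 2)%:E)%E.
    rewrite -ge0_integralZl_EFin ?exprn_ge0//.
    - by move=> x _; rewrite lee_fin sqr_ge0.
    - by apply/measurable_EFinP; exact: measurable_funX.
  rewrite (L2_rnormB_ae (u := u n.+1) (v := u n)); [|exact: L2_measurable..|exact: aeW|exact: aeW].
  have -> : 2 / (2 ^ n.+1)%:R = (2 ^+ n)^-1 :> R.
    by rewrite natrX exprS invfM mulrA divff// mul1r.
  rewrite -EFinM lee_fin -ler_pdivlMl ?exprn_gt0// -expr2 -exprVn.
  by rewrite ler_sqr ?nnegrE ?L2_rnorm_ge0// exprn_ge0// invr_ge0.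
have iS : mu.-integrable setT (fun x => \sum_(0 <= n <oo) s n x)%E.
  apply/integrableP; split.
    exact: (@ge0_emeasurable_sum _ _ _ _ _ xpredT).
  rewrite (eq_integral (fun x => \sum_(0 <= n <oo) s n x)%E); last first.
    by move=> x _; rewrite gee0_abs// nneseries_ge0.
  rewrite integral_nneseries//.
  apply: (@le_lt_trans _ _ (\sum_(0 <= n <oo) (2 / (2 ^ n.+1)%:R)%:E)%E).
    by apply: lee_nneseries => n _; [rewrite integral_ge0|].
  by apply: (le_lt_trans (epsilon_trick0 _ _)) => //; rewrite ltry.
apply: filterS (integrable_ae measurableT iS) => x /(_ I) fx.
have cD : cvgn (series (D^~ x)).
  apply: cvg_series_sqr_weighted => [n|]; first exact: RorC_abs_ge0.
  rewrite -ge0_fin_numE; first exact: fx.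
  by apply: nneseries_ge0 => n _ _; exact: s0.
apply: RorC_is_cvg; apply: (cvg_seq_of_abs_series _ cD) => n.
- by rewrite -RorC_reB RorC_le_re_abs.
- by rewrite -RorC_imB RorC_le_im_abs.
Qed.

(** The representatives u_n are set to 0 on a null set, so that they
  converge everywhere and the limit is measurable; Fatou's lemma, applied to
  |u_m - u_n|^2 as m grows, bounds the distance from the limit to u_n. *)
Lemma L2_fast_cauchy_cvg (u : nat -> L2) :
  (forall n m, (n <= m)%N -> L2_rnorm (u m - u n) <= 2^-1 ^+ n) ->
  exists v, forall n, L2_rnorm (v - u n) <= 2^-1 ^+ n.
Proof.
move=> uC.
have [|N [mN N0 sub]] := L2_fast_cauchy_ae_cvg (u := u).
  by move=> n; apply: uC.
pose f n x := RorC_mk k (\1_(~` N) x) 0 * u n x.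
have mf n : measurable_fun setT (f n).
  apply: measurable_RorCM; last exact: L2_measurable.
  apply/measurable_RorC; split.
  - rewrite (_ : _ \o _ = \1_(~` N)); last by apply/funext => x /=; rewrite RorC_re_mk.
    by apply: measurable_indic; exact: measurableC.
  - rewrite (_ : _ \o _ = cst 0); first exact: measurable_cst.
    by apply/funext => x /=; rewrite RorC_im_mk0.
have fE n x : ~ N x -> f n x = u n x.
  by move=> Nx; rewrite /f indicE mem_set//; case: (k) (u n x) => y; exact: mul1r.
have uf n : \forall x \ae mu, u n x = f n x.
  exists N; split=> // x /= ne; apply: contrapT => Nx; apply: ne.
  by rewrite fE.
have fv x : exists c : K, f n x @[n --> \oo] --> c.
  have [Nx|Nx] := pselect (N x).
    exists 0; rewrite (_ : (fun n => f n x) = fun=> 0); first exact: cvg_cst.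
    by apply/funext => n; rewrite /f indicE memNset ?RorC_mk0 ?mul0r//=; exact.
  have [c uc] : exists c : K, u n x @[n --> \oo] --> c.
    by apply: contrapT => ne; apply: Nx; apply: sub.
  by exists c; under eq_fun do rewrite fE//.
have {fv} [v fv] := choice fv.
have mv : measurable_fun setT v := measurable_RorC_limit mf fv.
have mB (g : X -> K) n : measurable_fun setT g -> measurable_fun setT (fun x => g x - f n x).
  by move=> mg; exact: measurable_RorCB.
have vf n : (\int[mu]_x (RorC_abs (v x - f n x) ^+ 2)%:E <= ((2^-1 ^+ n) ^+ 2)%:E)%E.
  pose F m x := (RorC_abs (f (m + n)%N x - f n x) ^+ 2)%:E.
  have Fv x : limn_einf (F^~ x) = (RorC_abs (v x - f n x) ^+ 2)%:E.
    apply: (cvg_limn_einf_sup _).1; apply: cvg_EFin; first exact: nearW.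
    rewrite /= [X in X @ _ --> _](_ : _ = fun m =>
      (RorC_re (f (m + n)%N x) - RorC_re (f n x)) ^+ 2 +
      (RorC_im (f (m + n)%N x) - RorC_im (f n x)) ^+ 2); last first.
      by apply/funext => m /=; rewrite RorC_sqr_abs RorC_reB RorC_imB.
    rewrite RorC_sqr_abs RorC_reB RorC_imB.
    have /cvg_RorC[hr hi] := fv x.
    have sh (h : nat -> R) (l : R) : h m @[m --> \oo] --> l ->
        (h (m + n)%N - h n) ^+ 2 @[m --> \oo] --> (l - h n) ^+ 2.
      move=> hl; under eq_fun do rewrite expr2; rewrite expr2.
      by apply: cvgM; (apply: cvgB; [rewrite (cvg_shiftn n)|exact: cvg_cst]).
    by apply: cvgD; [exact: (sh (fun m => RorC_re (f m x)))|exact: (sh (fun m => RorC_im (f m x)))].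
  have mF m : measurable_fun setT (F m) by apply: measurable_abs_sqr; exact: mB.
  have F0 m x : setT x -> (0 <= F m x)%E by move=> _; rewrite lee_fin sqr_ge0.
  have := fatou mu measurableT mF F0.
  rewrite (eq_integral (fun x => (RorC_abs (v x - f n x) ^+ 2)%:E)); last first.
    by move=> x _; exact: Fv.
  move/le_trans; apply; apply: limn_einf_le => m.
  rewrite (L2_rnormB_ae (mf _) (mf _) (uf _) (uf _)) lee_fin.
  by rewrite ler_sqr ?nnegrE ?L2_rnorm_ge0 ?exprn_ge0 ?invr_ge0// uC// leq_addl.
have sv : square_integrable mu v.
  have s0 : square_integrable mu (fun x => v x - f 0%N x).
    apply: square_integrable_lty; first exact: mB.
    by apply: le_lt_trans (vf 0%N) _; rewrite ltry.
  have sf : square_integrable mu (f 0%N).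
    apply: (square_integrable_ae (mf _) _ (L2_sqint (u 0%N))).
    by apply: filterS (uf 0%N) => x ->.
  have := square_integrableD s0 sf.
  by congr square_integrable; apply/funext => x; rewrite subrK.
exists (L2_of sv) => n.
rewrite -ler_sqr ?nnegrE ?L2_rnorm_ge0 ?exprn_ge0 ?invr_ge0// -lee_fin.
rewrite -(L2_rnormB_ae mv (mf n)) //; exact: L2_ofE.
Qed.

Lemma L2_rnormD u v : L2_rnorm (u + v) <= L2_rnorm u + L2_rnorm v.
Proof. by rewrite -(RorC_mk_le k) -RorC_mkD; exact: L2_norm_triangle. Qed.

Lemma ball_L2 u v (e : R) : ball u (RorC_mk k e 0) v <-> L2_rnorm (u - v) < e.
Proof. by rewrite -ball_normE /ball_/= L2_normE RorC_mk_lt. Qed.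

Lemma L2_rnormC u v : L2_rnorm (u - v) = L2_rnorm (v - u).
Proof.
by have := distrC u v; rewrite !L2_normE => /(congr1 (@RorC_re R k)); rewrite !RorC_re_mk.
Qed.

Lemma L2_rnorm_dist u v w : L2_rnorm (u - w) <= L2_rnorm (u - v) + L2_rnorm (v - w).
Proof. by have := L2_rnormD (u - v) (v - w); rewrite addrA subrK. Qed.

(** The centre u_n of a ball of radius 2^-(n+1) belonging to the filter is chosen
  for each n; any two such balls meet, so the sequence is fast Cauchy, and
  the filter converges to the limit of the sequence. *)
Lemma hilbert_space_L2 : hilbert_space L2.
Proof.
move=> F FF /cauchyP cF.
have h0 n : 0 < 2^-1 ^+ n :> R by rewrite exprn_gt0// invr_gt0.
have hS n : 2^-1 ^+ n.+1 + 2^-1 ^+ n.+1 = 2^-1 ^+ n :> R.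
  by rewrite -mulr2n exprS -mulrnAl -[_ *+ 2]mulr_natr mulVf// mul1r.
have /choice[u Fu] n : exists u : L2, F (ball u (RorC_mk k (2^-1 ^+ n.+1) 0)).
  by apply: cF; rewrite -(RorC_mk0 R) RorC_mk_lt.
have uC n m : (n <= m)%N -> L2_rnorm (u m - u n) <= 2^-1 ^+ n.
  move=> nm; have [w [/ball_L2 w1 /ball_L2 w2]] := filter_ex (filterI (Fu m) (Fu n)).
  apply: le_trans (L2_rnorm_dist _ w _) _; rewrite [X in _ + X]L2_rnormC.
  rewrite -[leRHS]hS; apply: lerD; apply: ltW => //.
  by apply: (lt_le_trans w1); rewrite ler_wiXn2l// ?invr_ge0// invf_le1// ler1n.
have [v vu] := L2_fast_cauchy_cvg uC.
apply/cvg_ex; exists v => U /nbhs_ballP[e /= e0 eU].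
have eE := RorC_ge0E (ltW e0).
have {}e0 : 0 < RorC_re e by rewrite -(RorC_mk_lt k) RorC_mk0 -eE.
(* The distances 2^-n from v to u n and 2^-(n+1) from u n to w add up to less
   than e once 2^-n < e / 2. *)
have [n _ /(_ n (leqnn n)) /= ne] := near_infty_natSinv_expn_lt (PosNum (divr_gt0 e0 (ltr0n R 2))).
apply: filterS (Fu n) => w /ball_L2 uw; apply: eU; rewrite eE; apply/ball_L2.
apply: le_lt_trans (L2_rnorm_dist _ (u n) _) _.
rewrite [RorC_re e]splitr; apply: ler_ltD.
  by apply: (le_trans (vu n)); rewrite exprVn -div1r ltW.
apply: (lt_trans uw); apply: le_lt_trans ne.
by rewrite div1r -exprVn ler_wiXn2l// ?invr_ge0// invf_le1// ler1n.
Qed.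
End completeness.

(** * The functional calculus *)

Theorem theorem2p9 (R : realType) (k : scalar_kind) (d : measure_display)
    (Omega : measurableType d) (mu : {measure set Omega -> \bar R}) :
  measurable_calculus (H := L2 k mu)
    (fun a : {mfun Omega >-> RorC R k} => mul_op mu a).
Proof.
split.
- exact: hilbert_space_L2.
- exact: closed_mul_op.
- apply/seteqP; split=> -[u v].
    by move=> /mul_opP uv; apply: L2_ext; apply: filterS uv => x ->; rewrite mul1r.
  move=> vu; apply/mul_opP; rewrite (vu : v = u).
  by apply: aeW => x; rewrite mul1r.
- move=> f g [u z] [v [w h]]; apply/mul_opP; move: h => /= [/mul_opP uv /mul_opP uw ->].
  apply: filterS3 (L2_DE v w) uv uw => x -> -> ->.
  by rewrite mulrDl.
- move=> c f [u z] [v uv e]; apply/mul_opP; move: uv e => /= /mul_opP uv ->.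
  by apply: filterS2 (L2_ZE c v) uv => x -> ->; rewrite mulrA.
- move=> f g [u w] [v /mul_opP uv /mul_opP vw]; apply/mul_opP.
  by apply: filterS2 uv vw => x e1 ->; rewrite e1 mulrA.
- move=> f g; apply/seteqP; split=> u.
    move=> [w [v /mul_opP uv /mul_opP vw]]; split; first by exists v; apply/mul_opP.
    by exists w; apply/mul_opP; apply: filterS2 uv vw => x e1 ->; rewrite e1 mulrA.
  move=> [[v uv] [w uw]]; exists w, v => //.
  move/mul_opP : uv => uv; move/mul_opP : uw => uw; apply/mul_opP.
  by apply: filterS2 uv uw => x /= -> ->; rewrite mulrA.
- exact: bounded_mul_op.
- by move=> f _; exact: op_adjoint_mul_op.
- by move=> f_ f [C fC]; exact: wot_cvg_mul_op fC.
Qed.
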